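(* Let $p,q\in\mathbb{R}$, let $0<\lambda\le\Lambda$ be constants, let $f:\mathbb{S}^n\to\mathbb{R}$ be measurable with $0<\lambda\le f\le\Lambda$, and let $g:\mathbb{S}^n\to\mathbb{R}$ be a positive Lipschitz function. Let $K_1,K_2\subset\mathbb{R}^{n+1}$ be convex bodies with $0\in\mathring K_1\cap\mathring K_2$ whose support functions both solve the $L_p$ dual Minkowski problem $$g\left(\frac{\nabla_{\mathbb{S}^n}h+h(\xi)\xi}{\sqrt{|\nabla_{\mathbb{S}^n}h|^2+h^2}}\right)\frac{\det\left(\nabla^2_{\mathbb{S}^n}h+h\,I\right)}{\left(h^2+|\nabla_{\mathbb{S}^n}h|^2\right)^{\frac{n+1-q}{2}}}=f(\xi)\,h^{p-1},\qquad \xi\in\mathbb{S}^n,$$ in the generalized (Aleksandrov) sense. If $p>q$, then $K_1=K_2$; if $p=q$, then $K_1$ equals $K_2$ up to dilation, i.e. $K_1=cK_2$ for some constant $c>0$.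
   Context: A convex body in $\mathbb{R}^{n+1}$ is a compact convex set with nonempty interior. For a convex body $K$ with $0\in\mathring K$: $h=h_K(\xi)=\sup_{x\in K}\langle x,\xi\rangle$ is the support function on $\mathbb{S}^n$; $\rho_K(\theta)=\max\{s:s\theta\in K\}$ is the radial function; $N_K(x)=\{\xi\in\mathbb{S}^n:(y-x)\cdot\xi\le0\ \forall y\in K\}$ for $x\in\partial K$; the Gauss image map is $\boldsymbol\alpha_K(A)=\bigcup_{\theta\in A}N_K(\rho_K(\theta)\theta)$ for $A\subset\mathbb{S}^n$; and the inverse Gauss image map is $\boldsymbol\alpha_K^*(\xi)=\{\theta\in\mathbb{S}^n:\xi\in\boldsymbol\alpha_K(\theta)\}$, $\boldsymbol\alpha^*_K(E)=\bigcup_{\xi\in E}\boldsymbol\alpha_K^*(\xi)$. The map $\boldsymbol\alpha^*_K$ is single valued almost everywhere. $\nabla_{\mathbb{S}^n}$ is the covariant derivative of the standard metric on $\mathbb{S}^n$ and $d\omega$ the standard volume measure. Formally the equation is $g\circ\boldsymbol\alpha_K^*\cdot\frac{d\boldsymbol\alpha_K^*(\omega)}{d\omega}=f\,\frac{(h_{K^*}\circ\boldsymbol\alpha^*_K)^q}{\rho_{K^*}^p}$, where $K^*=\{y:x\cdot y\le 1\ \forall x\in K\}$ is the polar body, $h_{K^*}=1/\rho_K$ and $\rho_{K^*}=1/h_K$ on $\mathbb{S}^n$. It is understood in the sense of measures: for every Borel $E\subset\mathbb{S}^n$, $$\int_{\boldsymbol\alpha_K^*(E)}g\,d\omega=\int_E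 f(\xi)\,h_K(\xi)^p\,\rho_K(\boldsymbol\alpha_K^*(\xi))^{-q}\,d\omega(\xi).$$ *)

(* Defs.v *)
From HB Require Import structures.
From mathcomp Require Import all_boot all_order all_algebra.
From mathcomp Require Import all_classical all_reals all_analysis.

Set Implicit Arguments.
Unset Strict Implicit.
Unset Printing Implicit Defensive.

Import Order.TTheory GRing.Theory Num.Theory.
Import numFieldNormedType.Exports.

Local Open Scope classical_set_scope.
Local Open Scope ring_scope.

(* Lebesgue measure on the product Borel sigma-algebra of n.-tuple R, as the
   n-fold iterated product of the one-dimensional Lebesgue measure. *)
Section lebesgue_tuple.
Context {R : realType}.
Local Notation RR := (measurableTypeR R).
Local Open Scope ereal_scope.

Fixpoint lebesgue_tuple (n : nat) : set (n.-tuple RR) -> \bar R :=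
  match n with
  | 0 => dirac [tuple]
  | m.+1 => pushforward (lebesgue_measure \x @lebesgue_tuple m)
              (fun p => [tuple of p.1 :: p.2])
  end.

Let pack_sigma_finite d (T : measurableType d)
    (m : {measure set T -> \bar R}) : sigma_finite setT m ->
  exists mu : {sigma_finite_measure set T -> \bar R},
    mu = m :> (set T -> \bar R).
Proof.
case: m => m mC /= sf.
pose H := @Measure_isSigmaFinite.Build d T R (Measure.Pack mC) sf.
pose s : {sigma_finite_measure set T -> \bar R} := HB.pack m mC H.
by exists s.
Qed.

Let lebesgue_tuple_ex (n : nat) :
  exists mu : {sigma_finite_measure set (n.-tuple RR) -> \bar R},
    mu = @lebesgue_tuple n :> (set _ -> \bar R).
Proof.
elim: n => [|n [mu muE]].
  apply: (pack_sigma_finite (m := dirac [tuple])).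
  apply: fin_num_fun_sigma_finite => [|A mA]; last by rewrite /= diracE.
  by rewrite measure0.
rewrite /= -muE.
pose c (p : RR * n.-tuple RR) : n.+1.-tuple RR := [tuple of p.1 :: p.2].
have mc : measurable_fun setT c by exact: measurable_cons.
pose d (t : n.+1.-tuple RR) : RR * n.-tuple RR := (thead t, [tuple of behead t]).
have md : measurable_fun setT d.
  apply: measurable_fun_pair; first exact: measurable_tnth.
  exact: measurable_behead.
have cd t : c (d t) = t by rewrite /c /d /=; exact/esym/tuple_eta.
have dc p : d (c p) = p.
  by case: p => x y; rewrite /c /d /=; congr (_, _); exact: val_inj.
have [m mE] : exists m : {measure set (n.+1.-tuple RR) -> \bar R},
    m = pushforward (lebesgue_measure \x mu) c :> (set _ -> \bar R).
  unshelve eexists; last first.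
    by refine (erefl (pushforward _ _)); exact: mc.
have sf : sigma_finite setT m.
  rewrite mE.
  have /sigma_finiteP[F [FT ndF Foo]] := sigma_finiteT (@lebesgue_measure R).
  have /sigma_finiteP[G [GT ndG Goo]] := sigma_finiteT mu.
  exists (fun k => d @^-1` (F k `*` G k)).
    apply/esym; rewrite -subTset => t _.
    have : setT (d t).1 by [].
    rewrite FT => -[i _ Fi].
    have : setT (d t).2 by [].
    rewrite GT => -[j _ Gj].
    exists (maxn i j) => //; split.
      by move: Fi; exact/subsetPset/ndF/leq_maxl.
    by move: Gj; exact/subsetPset/ndG/leq_maxr.
  move=> k; have [mF Fk] := Foo k; have [mG Gk] := Goo k; split.
    by rewrite -[X in measurable X]setTI; apply: md => //; exact: measurableX.
  rewrite /pushforward (_ : c @^-1` _ = F k `*` G k); last first.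
    by apply/seteqP; split => p; rewrite /preimage /mkset dc.
  by rewrite product_measure1E// lte_mul_pinfty// ge0_fin_numE.
have [s sE] := pack_sigma_finite sf.
by exists s; rewrite sE mE.
Qed.

Let lebesgue_tuple0 n : @lebesgue_tuple n set0 = 0.
Proof. by have [mu <-] := lebesgue_tuple_ex n; exact: measure0. Qed.

Let lebesgue_tuple_ge0 n A : 0 <= @lebesgue_tuple n A.
Proof. by have [mu <-] := lebesgue_tuple_ex n; exact: measure_ge0. Qed.

Let lebesgue_tuple_semi_sigma_additive n :
  semi_sigma_additive (@lebesgue_tuple n).
Proof.
by have [mu <-] := lebesgue_tuple_ex n; exact: measure_semi_sigma_additive.
Qed.

HB.instance Definition _ n := isMeasure.Build _ _ _ (@lebesgue_tuple n)
  (lebesgue_tuple0 n) (@lebesgue_tuple_ge0 n)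
  (@lebesgue_tuple_semi_sigma_additive n).

Let lebesgue_tuple_sigma_finite n : sigma_finite setT (@lebesgue_tuple n).
Proof. by have [mu <-] := lebesgue_tuple_ex n; exact: sigma_finiteT. Qed.

HB.instance Definition _ n := @Measure_isSigmaFinite.Build _ _ _
  (@lebesgue_tuple n) (lebesgue_tuple_sigma_finite n).

End lebesgue_tuple.
Arguments lebesgue_tuple {R} n.

Section euclidean.
Context {R : realType} {m : nat}.
Implicit Types (x y : 'rV[R]_m) (A K : set 'rV[R]_m).

Definition dot x y : R := \sum_i x ord0 i * y ord0 i.

Definition sphere : set 'rV[R]_m := [set x | dot x x = 1].

(* The library's topology on 'rV[R]_m is the one of the sup norm, which is the
   Euclidean topology. *)
Definition borel A := <<s [set U : set 'rV[R]_m | open U] >> A.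

Definition cone A : set 'rV[R]_m :=
  [set x | exists r theta, [/\ 0 < r <= 1, A theta & x = r *: theta]].

Definition convex_body K :=
  [/\ compact K, convex_set (K : set (convex_lmodType 'rV[R]_m)) & K° !=set0].

End euclidean.

(* The volume measure omega of the sphere, through polar coordinates:
   omega(A) = m * Leb{r theta | 0 < r <= 1, theta \in A} for A a subset of
   S^(m-1).  It is first an outer measure on subsets of 'rV[R]_m (which only
   sees their trace on the sphere), built from Lebesgue outer measure on
   m-tuples; restricting it to its Caratheodory sigma-algebra gives the
   completed volume measure, so that "measurable" means Lebesgue measurable. *)
Section sphere_measure.
Context {R : realType} {m : nat}.
Local Open Scope ereal_scope.

Definition sphere_outer_measure (A : set 'rV[R]_m) : \bar R :=
  m%:R%:E * ((lebesgue_tuple m)^*)%mu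
    [set t : m.-tuple R | cone (A `&` sphere) (\row_i tnth t i)].

Let leb : {outer_measure set _ -> \bar R} := ((lebesgue_tuple m)^*)%mu.

Let sphere_outer0 : sphere_outer_measure set0 = 0.
Proof.
rewrite /sphere_outer_measure (_ : mkset _ = set0).
  by rewrite (outer_measure0 leb) mule0.
by rewrite -subset0 => t /= [r [theta [_ []]]].
Qed.

Let sphere_outer_ge0 A : 0 <= sphere_outer_measure A.
Proof.
by rewrite mule_ge0 ?lee_fin ?ler0n//; exact: (outer_measure_ge0 leb).
Qed.

Let le_sphere_outer : {homo sphere_outer_measure : A B / A `<=` B >-> A <= B}.
Proof.
move=> A B AB; apply: lee_wpmul2l; first by rewrite lee_fin ler0n.
apply: (le_outer_measure leb) => t /= [r [theta [r01 [Ath Sth] ->]]].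
by exists r, theta; split => //; split => //; exact: AB.
Qed.

Let sphere_outer_sigma_subadditive : sigma_subadditive sphere_outer_measure.
Proof.
move=> F; rewrite nneseriesZl; last first.
  by move=> k _; exact: (outer_measure_ge0 leb).
apply: lee_wpmul2l; first by rewrite lee_fin ler0n.
apply: le_trans (outer_measure_sigma_subadditive leb _).
apply: (le_outer_measure leb) => t /= [r [theta [r01 [[k _ Fk] Sth] tE]]].
by exists k => //=; exists r, theta.
Qed.

HB.instance Definition _ := isOuterMeasure.Build R 'rV[R]_m
  sphere_outer_measure sphere_outer0 sphere_outer_ge0 le_sphere_outer
  sphere_outer_sigma_subadditive.

Definition sphere_type : Type := caratheodory_type sphere_outer_measure.
HB.instance Definition _ := Measurable.on sphere_type.

Definition sphere_measure : set sphere_type -> \bar R := sphere_outer_measure.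

HB.instance Definition _ := isMeasure.Build _ _ _ sphere_measure
  (@caratheodory_measure0 R _ sphere_outer_measure)
  (@caratheodory_measure_ge0 R _ sphere_outer_measure)
  (@caratheodory_measure_sigma_additive R _ sphere_outer_measure).

End sphere_measure.

Section convex_geometry.
Context {R : realType} {m : nat} (K : set 'rV[R]_m).
Implicit Types (x xi theta : 'rV[R]_m) (A E : set 'rV[R]_m).

Definition support xi : R := sup [set dot x xi | x in K].

Definition radial theta : R := sup [set s : R | K (s *: theta)].

(* The unit outer normals N_K(x); empty when x is interior, and only evaluated
   at the boundary points rho_K(theta) theta. *)
Definition normals x : set 'rV[R]_m :=
  [set xi | sphere xi /\ forall y, K y -> dot (y - x) xi <= 0].

Definition gauss_image A : set 'rV[R]_m :=
  \bigcup_(theta in A) normals (radial theta *: theta).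

Definition inv_gauss xi : set 'rV[R]_m :=
  [set theta | sphere theta /\ gauss_image [set theta] xi].

Definition inv_gauss_image E : set 'rV[R]_m := \bigcup_(xi in E) inv_gauss xi.

(* inv_gauss as a single valued map: an arbitrary selection, determined for
   almost every xi. *)
Definition inv_gauss_fun xi : 'rV[R]_m := xget 0 (inv_gauss xi).

End convex_geometry.

(* h_K solves the L_p dual Minkowski problem with data f, g in the generalized
   (Aleksandrov) sense. *)
Definition generalized_solution {R : realType} {m : nat} (p q : R)
    (f g : 'rV[R]_m -> R) (K : set 'rV[R]_m) :=
  forall E : set 'rV[R]_m, borel E -> E `<=` sphere ->
    (\int[sphere_measure]_(theta in inv_gauss_image K E) (g theta)%:E =
     \int[sphere_measure]_(xi in E)
       (f xi * support K xi `^ p *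
        radial K (inv_gauss_fun K xi) `^ (- q))%:E)%E.

(* Main.v *)
Require Import Defs.
From mathcomp Require Import all_boot all_order all_algebra.
From mathcomp Require Import all_classical all_reals all_analysis.
From mathcomp Require Import measurable_realfun ring lra.

Set Implicit Arguments.
Unset Strict Implicit.
Unset Printing Implicit Defensive.

Import Order.TTheory GRing.Theory Num.Theory.
Import numFieldNormedType.Exports.

Local Open Scope classical_set_scope.
Local Open Scope ring_scope.

(** Write theta_i(xi) for the (almost everywhere unique) direction of the
    boundary point of K_i with normal xi, r = h_1 / h_2 and
    s = rho_1 / rho_2.  Since h_i(xi) is the maximum over theta of
    rho_i(theta) <theta, xi>, attained at theta_i(xi), one has
        s(theta_2(xi)) <= r(xi) <= s(theta_1(xi)).
    The equation says that theta_i pushes f h_i^p dxi to g rho_i^q dtheta.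
    Pushing a function of the form rho_2^q kap(s) forward by theta_1 and by
    theta_2, where kap(x) and x^(-q) kap(x) are nonnegative and nondecreasing,
    gives
        int f h_2^p r^(p-q) kap(r) <= int f h_2^p kap(s(theta_2))
                                   <= int f h_2^p kap(r).
    If p > q, a kap supported in ]1, +oo[ forces r <= 1, and K_1 = K_2 by
    symmetry.  If p = q, all these are equalities, hence s(theta_2) = r and
    theta_2 = theta_1 almost everywhere.  By density and compactness,
    ln h_1 and ln h_2 then have a common subgradient at every xi, so that r
    is constant. *)

(* mathcomp's [support] (of a function) shadows the one of [Defs]. *)
Local Notation support := Defs.support.

(** The bodies need not be smooth or strictly convex, so no change of variables formula applies to
    theta_i. Three arguments replace it. The normals with a nondegenerate face form a null set by
    Fubini along coordinate lines of the solid cone. The equation, applied to that very set of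
    normals, shows that its image is null too, so that the directions missed by theta_i do not
    count. Finally r is shown to be constant without differentiating it: along a segment, the errors
    of a discrete comparison telescope.

    The two monotonicity conditions on kap answer the two replacements in the chain: r by s(theta_1)
    inside x^(-q) kap(x), and s(theta_2) by r inside kap(x). A factor x^max(q,0) provides both,
    whatever the sign of q, and leaves a free nondecreasing weight to be adapted to each case.

    For p = q the ratio is propagated along segments that avoid the origin, hence between
    non-antipodal directions; antipodal ones are joined through a third direction, which is where n
    > 0 enters. *)

Local Notation borel_rV R m :=
  (g_sigma_algebraType [set U : set 'rV[R]_m | open U]).

(** * The Euclidean structure of row vectors *)

Section level_sets.
Context {R : realType} {T : topologicalType} (u v : T -> R).
Hypotheses (cu : continuous u) (cv : continuous v).

Let cuv : continuous (fun x => u x - v x).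
Proof. by move=> x; apply: cvgB; [exact: cu|exact: cv]. Qed.

Lemma closed_le_fun : closed [set x | u x <= v x].
Proof.
have /continuous_closedP/(_ _ (@closed_le R 0)) := cuv.
by congr closed; apply/seteqP; split=> x /=; rewrite subr_le0.
Qed.

Lemma closed_eq_fun : closed [set x | u x = v x].
Proof.
have /continuous_closedP/(_ _ (@closed_eq R 0)) := cuv.
by congr closed; apply/seteqP; split=> x /=;
  [move/eqP; rewrite subr_eq0 => /eqP|move=> ->; rewrite subrr].
Qed.

Lemma open_lt_fun : open [set x | u x < v x].
Proof.
have /continuousP/(_ _ (@open_lt R 0)) := cuv.
by congr open; apply/seteqP; split=> x /=; rewrite subr_lt0.
Qed.

End level_sets.

Section dot_theory.
Context {R : realType} {m : nat}.
Implicit Types (x y z : 'rV[R]_m) (c : R).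

Lemma dotC x y : dot x y = dot y x.
Proof. by apply: eq_bigr => i _; rewrite mulrC. Qed.

Lemma dotDl x y z : dot (x + y) z = dot x z + dot y z.
Proof. by rewrite -big_split; apply: eq_bigr => i _ /=; rewrite mxE mulrDl. Qed.

Lemma dotZl c x y : dot (c *: x) y = c * dot x y.
Proof. by rewrite /dot mulr_sumr; apply: eq_bigr => i _; rewrite mxE mulrA. Qed.

Lemma dotDr x y z : dot x (y + z) = dot x y + dot x z.
Proof. by rewrite dotC dotDl !(dotC _ x). Qed.

Lemma dotZr c x y : dot x (c *: y) = c * dot x y.
Proof. by rewrite dotC dotZl dotC. Qed.

Lemma dotNl x y : dot (- x) y = - dot x y.
Proof. by rewrite -scaleN1r dotZl mulN1r. Qed.

Lemma dotNr x y : dot x (- y) = - dot x y.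
Proof. by rewrite dotC dotNl dotC. Qed.

Lemma dotBl x y z : dot (x - y) z = dot x z - dot y z.
Proof. by rewrite dotDl dotNl. Qed.

Lemma dotBr x y z : dot x (y - z) = dot x y - dot x z.
Proof. by rewrite dotDr dotNr. Qed.

Lemma dot0l y : dot 0 y = 0.
Proof. by rewrite -(scale0r 0) dotZl mul0r. Qed.

Lemma dot_ge0 x : 0 <= dot x x.
Proof. by apply: sumr_ge0 => i _; rewrite -expr2 sqr_ge0. Qed.

Lemma dot_eq0 x : (dot x x == 0) = (x == 0).
Proof.
apply/eqP/eqP => [x0|->]; last by rewrite dot0l.
apply/rowP => i; rewrite mxE; apply/eqP; rewrite -sqrf_eq0 expr2; apply/eqP.
by move/psumr_eq0P : x0 => -> // j _; rewrite -expr2 sqr_ge0.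
Qed.

Lemma dot_gt0 x : (0 < dot x x) = (x != 0).
Proof. by rewrite lt_def dot_ge0 andbT dot_eq0. Qed.

Lemma coord_le_norm x i : `|x ord0 i| <= `|x|.
Proof.
rewrite [leRHS]/Num.norm /= mx_normrE; apply/bigmax_geP; right => /=.
by exists (ord0, i).
Qed.

(** The norm is the sup norm, hence the factor [m]; only finiteness and continuity are at stake,
    never the sharp constant. *)
Lemma dot_le_norm x y : `|dot x y| <= m%:R * (`|x| * `|y|).
Proof.
apply: le_trans (ler_norm_sum _ _ _) _.
have -> : m%:R * (`|x| * `|y|) = \sum_(i < m) `|x| * `|y|.
  by rewrite sumr_const card_ord mulr_natl.
by apply: ler_sum => i _; rewrite normrM ler_pM// coord_le_norm.
Qed.

Lemma continuous_dot : continuous (fun z : 'rV[R]_m * 'rV[R]_m => dot z.1 z.2).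
Proof.
apply: continuous_big => [|i _ z]; first exact: add_continuous.
by apply: cvgM; [apply: (continuous_comp (g := fun x => x ord0 i))|
  apply: (continuous_comp (g := fun x => x ord0 i))];
  [exact: cvg_fst|exact: coord_continuous|exact: cvg_snd|exact: coord_continuous].
Qed.

Lemma cvg_dot {T : Type} {F : set_system T} {FF : Filter F}
    (f g : T -> 'rV[R]_m) x y :
  f @ F --> x -> g @ F --> y -> (fun t => dot (f t) (g t)) @ F --> dot x y.
Proof.
move=> fx gy; apply: (@continuous2_cvg _ _ _ _ F FF f g (fun x y => dot x y)) => //.
exact: continuous_dot (x, y).
Qed.

Lemma sphere_neq0 x : sphere x -> x != 0.
Proof. by rewrite /sphere /= -dot_gt0 => ->. Qed.

Lemma sphere_norm_le1 x : sphere x -> `|x| <= 1.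
Proof.
move=> Sx; rewrite [leLHS]/Num.norm /= mx_normrE; apply/bigmax_leP; split => //=.
move=> [i j] _ /=; rewrite (ord1 i).
rewrite -(@ler_pXn2r _ 2) ?nnegrE// expr1n real_normK ?num_real//.
rewrite -[leRHS]Sx /dot (bigD1 j)//= -expr2 lerDl.
by apply: sumr_ge0 => k _; rewrite -expr2 sqr_ge0.
Qed.

Lemma sphere_compact : compact (sphere : set 'rV[R]_m).
Proof.
apply: bounded_closed_compact.
  exists 1; split; first exact: num_real.
  by move=> M M1 x Sx /=; rewrite (le_trans (sphere_norm_le1 _))// ltW.
apply: (closed_eq_fun (u := fun x => dot x x) (v := cst 1)) => x.
  exact: (@cvg_dot _ (nbhs x) _ id id x x).
exact: cst_continuous.
Qed.

Lemma normalize_sphere x : x != 0 -> sphere ((Num.sqrt (dot x x))^-1 *: x).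
Proof.
rewrite -dot_gt0 => x0; rewrite /sphere /= dotZl dotZr mulrA -expr2 exprVn.
by rewrite sqr_sqrtr ?ltW// mulVf// gt_eqF.
Qed.

Lemma normalizeK x : x != 0 ->
  x = Num.sqrt (dot x x) *: ((Num.sqrt (dot x x))^-1 *: x).
Proof.
by rewrite -dot_gt0 => x0; rewrite scalerA divff ?scale1r// gt_eqF// sqrtr_gt0.
Qed.

End dot_theory.

Lemma convex_setP {R : realType} {m : nat} (K : set 'rV[R]_m) :
  convex_set (K : set (convex_lmodType 'rV[R]_m)) ->
  forall x y t, K x -> K y -> 0 <= t <= 1 -> K (t *: x + (1 - t) *: y).
Proof.
move=> Kconv x y t Kx Ky t01.
have := Kconv x y (Itv01 (proj1 (andP t01)) (proj2 (andP t01))).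
by rewrite !inE; apply.
Qed.

(** * Support and radial functions *)

Section convex_body_theory.
Context {R : realType} {m : nat} (K : set 'rV[R]_m).
Hypotheses (Kbody : convex_body K) (Kint0 : K° 0).
Implicit Types (x y xi theta : 'rV[R]_m) (c t : R).

Let Kcompact : compact K. Proof. by case: Kbody. Qed.

Let Kconvex x y t : K x -> K y -> 0 <= t <= 1 -> K (t *: x + (1 - t) *: y).
Proof. by case: Kbody => _ /convex_setP + _; exact. Qed.

Lemma body0 : K 0.
Proof. exact: interior_subset. Qed.

Lemma body_closed : closed K.
Proof. by apply: compact_closed => //; exact: norm_hausdorff. Qed.

Lemma body_star x t : K x -> 0 <= t <= 1 -> K (t *: x).
Proof. by move=> Kx t01; have := Kconvex Kx body0 t01; rewrite scaler0 addr0. Qed.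

Lemma body_bounded : exists2 M, 0 < M & forall x, K x -> `|x| <= M.
Proof.
have /compact_bounded[M [_ MK]] := Kcompact.
exists (`|M| + 1); first by rewrite ltr_wpDl.
by move=> x Kx; apply: MK => //; rewrite ltr_pwDr// ler_norm.
Qed.

Lemma body_inner : exists2 e, 0 < e & forall x, `|x| <= e -> K x.
Proof.
have /nbhs_ballP[e /= e0 eK] := Kint0.
exists (e / 2); first by rewrite divr_gt0.
move=> x xe; apply: eK; rewrite -ball_normE /= sub0r normrN.
by rewrite (le_lt_trans xe)// ltr_pdivrMr// ltr_pMr// ltr1n.
Qed.

Let dot_has_sup xi : has_sup [set dot x xi | x in K].
Proof.
split; first by exists (dot 0 xi); exists 0 => //; exact: body0.
have [M M0 KM] := body_bounded.
exists (m%:R * (M * `|xi|)) => _ [x Kx <-].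
rewrite (le_trans (ler_norm _))// (le_trans (dot_le_norm _ _))//.
by rewrite ler_wpM2l// ler_wpM2r// KM.
Qed.

Lemma dot_le_support x xi : K x -> dot x xi <= support K xi.
Proof. by move=> Kx; apply: ub_le_sup; [case: (dot_has_sup xi)|exists x]. Qed.

Lemma support_le xi c : (forall x, K x -> dot x xi <= c) -> support K xi <= c.
Proof.
move=> Kc; apply: ge_sup; first by case: (dot_has_sup xi).
by move=> _ [x Kx <-]; exact: Kc.
Qed.

Lemma support_attained xi : exists2 x, K x & dot x xi = support K xi.
Proof.
have K0 : K !=set0 by exists 0; exact: body0.
have cd : {within K, continuous (fun x => dot x xi)}.
  apply: continuous_subspaceT => x.
  exact: (@cvg_dot _ _ _ (nbhs x) _ id (cst xi) x xi _ (cvg_cst _)).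
have [x /set_mem Kx xmax] := EVT_max_rV K0 Kcompact cd.
exists x => //; apply/eqP; rewrite eq_le dot_le_support//=.
by apply: support_le => y Ky; apply: xmax; rewrite inE.
Qed.

Lemma supportZ c xi : 0 <= c -> support K (c *: xi) = c * support K xi.
Proof.
move=> c0; apply/eqP; rewrite eq_le; apply/andP; split.
  by apply: support_le => x Kx; rewrite dotZr ler_wpM2l// dot_le_support.
have [x Kx <-] := support_attained xi.
by rewrite -dotZr dot_le_support.
Qed.

Lemma support_lip : exists2 M, 0 <= M &
  forall xi eta, `|support K xi - support K eta| <= M * `|xi - eta|.
Proof.
have [M M0 KM] := body_bounded.
exists (m%:R * M); first by rewrite mulr_ge0// ltW.
have H xi eta : support K xi - support K eta <= m%:R * M * `|xi - eta|.
  have [x Kx <-] := support_attained xi.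
  rewrite lerBlDr -lerBlDl (le_trans _ (dot_le_support eta Kx))//.
  rewrite lerBlDr -lerBlDl -dotBr (le_trans (ler_norm _))//.
  by rewrite (le_trans (dot_le_norm _ _))// -mulrA ler_wpM2l// ler_wpM2r// KM.
by move=> xi eta; rewrite ler_norml lerNl opprB {1}distrC !H.
Qed.

Lemma continuous_support : continuous (support K).
Proof.
have [M M0 HM] := support_lip.
move=> xi; apply/(@cvgrPdist_le _ _ _ (nbhs xi)) => /= e e0.
have M1 : 0 < M + 1 by rewrite ltr_wpDl.
apply/nbhs_ballP; exists (e / (M + 1)); first by rewrite /= divr_gt0.
move=> eta; rewrite -ball_normE /= ltr_pdivlMr// mulrC => /ltW; apply: le_trans.
by rewrite (le_trans (HM _ _))// ler_wpM2r// lerDl.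
Qed.

Lemma support_ge : exists2 r, 0 < r &
  forall xi, sphere xi -> r <= support K xi.
Proof.
have [e e0 eK] := body_inner.
exists e => // xi Sxi.
have -> : e = dot (e *: xi) xi by rewrite dotZl Sxi mulr1.
apply/dot_le_support/eK.
by rewrite normrZ gtr0_norm// ler_piMr ?(ltW e0)// sphere_norm_le1.
Qed.

Lemma support_gt0 xi : xi != 0 -> 0 < support K xi.
Proof.
move=> xi0; have [r r0 rh] := support_ge.
rewrite (normalizeK xi0) supportZ ?sqrtr_ge0//.
rewrite mulr_gt0// ?sqrtr_gt0 ?dot_gt0//.
exact/(lt_le_trans r0)/rh/normalize_sphere.
Qed.

Section radial.
Variable theta : 'rV[R]_m.
Hypothesis Stheta : sphere theta.

Let radial_set := [set s : R | K (s *: theta)].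

Let theta_norm_gt0 : 0 < `|theta|.
Proof. by rewrite normr_gt0 sphere_neq0. Qed.

Let radial_has_sup : has_sup radial_set.
Proof.
split; first by exists 0; rewrite /radial_set /= scale0r; exact: body0.
have [M M0 KM] := body_bounded.
exists (M / `|theta|) => s /KM; rewrite normrZ => sM.
by rewrite ler_pdivlMr// (le_trans _ sM)// ler_wpM2r// ler_norm.
Qed.

Lemma radial_body : K (radial K theta *: theta).
Proof.
have cl : closed radial_set.
  have /continuous_closedP : continuous (fun s : R => s *: theta).
    by move=> s; apply: cvgZr_tmp; exact: cvg_id.
  by apply; exact: body_closed.
by case: radial_has_sup => r0 rb; apply: cl; exact: closure_sup.
Qed.

Lemma radial_ge s : K (s *: theta) -> s <= radial K theta.
Proof. by move=> Ks; apply: ub_le_sup => //; case: radial_has_sup. Qed.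

Lemma radial_gt0 : 0 < radial K theta.
Proof.
have [e e0 eK] := body_inner.
apply: (@lt_le_trans _ _ (e / `|theta|)); first by rewrite divr_gt0.
apply/radial_ge/eK; rewrite normrZ gtr0_norm ?divr_gt0//.
by rewrite divfK// gt_eqF.
Qed.

Lemma radial_leP s : 0 <= s -> s <= radial K theta <-> K (s *: theta).
Proof.
move=> s0; split; last exact: radial_ge.
move=> sr; have := body_star (t := s / radial K theta) radial_body.
rewrite scalerA divfK ?gt_eqF ?radial_gt0//; apply.
by rewrite divr_ge0 ?(ltW radial_gt0)//= ler_pdivrMr ?radial_gt0 ?mul1r.
Qed.

Lemma radial_dot_le xi : radial K theta * dot theta xi <= support K xi.
Proof. by rewrite -dotZl; exact/dot_le_support/radial_body. Qed.

End radial.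

(** A unit normal at a boundary point is a functional that attains its maximum over [K] there, which
    is the equality case of [radial_dot_le]. This form has no quantifier over [K]. *)
Lemma inv_gaussP xi theta : inv_gauss K xi theta <->
  [/\ sphere xi, sphere theta & radial K theta * dot theta xi = support K xi].
Proof.
split.
  move=> [St [_ ->]] [Sx H]; split=> //; apply/eqP; rewrite eq_le.
  rewrite radial_dot_le//=; apply: support_le => y /H.
  by rewrite dotBl subr_le0 dotZl.
move=> [Sx St E]; split=> //; exists theta => //; split=> // y Ky.
by rewrite dotBl subr_le0 dotZl E dot_le_support.
Qed.

Lemma inv_gauss_nonempty xi : sphere xi -> exists theta, inv_gauss K xi theta.
Proof.
move=> Sxi; have [x Kx xE] := support_attained xi.
have x0 : x != 0.
  apply: contraPneq xE => ->; rewrite dot0l.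
  by apply/eqP; rewrite lt_eqF// support_gt0// sphere_neq0.
have Sx := normalize_sphere x0.
exists ((Num.sqrt (dot x x))^-1 *: x); apply/inv_gaussP; split=> //.
apply/eqP; rewrite eq_le radial_dot_le//= -xE {1}(normalizeK x0) dotZl.
rewrite ler_wpM2r//; last by apply: radial_ge => //; rewrite -normalizeK.
by rewrite dotZl xE mulr_ge0 ?invr_ge0 ?sqrtr_ge0// ltW// support_gt0// sphere_neq0.
Qed.

(** For [x] outside [K] and [y] the nearest point of [K], the direction [x - y] separates strictly:
    otherwise moving from [y] inside [K] would shorten the distance. *)
Lemma body_separation x :
  (forall xi, sphere xi -> dot x xi <= support K xi) -> K x.
Proof.
move=> xh; apply: contrapT => nKx.
have K0 : K !=set0 by exists 0; exact: body0.
have cd : {within K, continuous (fun y => dot (x - y) (x - y))}.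
  apply: continuous_subspaceT => y.
  have cB : (fun w => x - w) @ y --> x - y.
    exact: (cvgB (cvg_cst x) (@cvg_id _ (nbhs y))).
  exact: (cvg_dot cB cB).
have [y /set_mem Ky ymin] := EVT_min_rV K0 Kcompact cd.
have z0 : x - y != 0.
  by rewrite subr_eq0; apply: contra_notN nKx => /eqP ->.
have key w : K w -> dot (w - y) (x - y) <= 0.
  move=> Kw; rewrite leNgt; apply/negP => d0.
  pose D := dot (w - y) (w - y).
  pose d := dot (w - y) (x - y).
  have D0 : 0 <= D := dot_ge0 _.
  have D1 : 0 < D + d by rewrite ltr_wpDl.
  (* The squared distance drops by t (2 d - t D). Unlike the optimal d / D, this quotient always
     lies in ]0, 1], and it still gives t D < 2 d. *)
  pose t := d / (D + d).
  have t0 : 0 < t by rewrite divr_gt0.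
  have t1 : t <= 1 by rewrite ler_pdivrMr// mul1r lerDr.
  have Kt : K (t *: w + (1 - t) *: y) by apply: Kconvex; rewrite ?(ltW t0).
  have := ymin _ (mem_set Kt).
  have -> : x - (t *: w + (1 - t) *: y) = (x - y) - t *: (w - y).
    by apply/rowP => i; rewrite !mxE; ring.
  have sq (z v : 'rV[R]_m) : dot (z - t *: v) (z - t *: v) =
      dot z z - t * (2 * dot v z - t * dot v v).
    by rewrite !dotBl !dotBr !dotZl !dotZr (dotC z v); ring.
  rewrite sq -/d -/D => H.
  have : t * (2 * d - t * D) <= 0 by lra.
  rewrite pmulr_rle0// subr_le0 leNgt => /negP; apply.
  rewrite /t mulrAC ltr_pdivrMr//.
  have dD : 0 <= d * D by rewrite mulr_ge0// ltW.
  have dd : 0 < d * d by rewrite mulr_gt0.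
  by rewrite mulrDr -!mulrA; lra.
have Sz := normalize_sphere z0.
have := xh _ Sz; rewrite leNgt => /negP; apply.
apply: (@le_lt_trans _ _ (dot y ((Num.sqrt (dot (x - y) (x - y)))^-1 *: (x - y)))).
  apply: support_le => w Kw; rewrite !dotZr ler_wpM2l ?invr_ge0 ?sqrtr_ge0//.
  by rewrite -subr_le0 -dotBl key.
rewrite !dotZr ltr_pM2l ?invr_gt0 ?sqrtr_gt0 ?dot_gt0//.
by rewrite -subr_gt0 -dotBl dot_gt0.
Qed.

(** Without a normal, the gap between the support function and the product with the boundary point
    would have a positive minimum [d] on the compact sphere. By [body_separation] the point could
    then move outwards along [theta] and stay in [K], against the maximality of its radius. *)
Lemma gauss_nonempty theta : sphere theta -> exists xi, inv_gauss K xi theta.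
Proof.
move=> St; set x := radial K theta *: theta.
have S0 : (sphere : set 'rV[R]_m) !=set0 by exists theta.
have cd : {within sphere, continuous (fun xi => support K xi - dot x xi)}.
  apply: continuous_subspaceT => xi.
  have cd : (fun eta => dot x eta) @ xi --> dot x xi.
    exact: (cvg_dot (cvg_cst x) (@cvg_id _ (nbhs xi))).
  exact: (cvgB (@continuous_support xi) cd).
have [xi /set_mem Sxi ximin] := EVT_min_rV S0 sphere_compact cd.
exists xi; apply/inv_gaussP; split=> //; apply/eqP; rewrite eq_le radial_dot_le//=.
rewrite leNgt; apply/negP; rewrite -dotZl -/x -subr_gt0.
set d := (X in 0 < X) => d0.
(* [M] bounds the product of [theta] with unit vectors, so adding d / (M + 1) times [theta] uses up
   at most the gap [d]. *)
pose M : R := m%:R * `|theta|.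
have M0 : 0 < M + 1 by rewrite ltr_wpDl// mulr_ge0.
suff : radial K theta + d / (M + 1) <= radial K theta.
  by rewrite gerDl leNgt divr_gt0.
apply: radial_ge => //; apply: body_separation => eta Seta.
rewrite scalerDl -/x dotDl dotZl.
apply: (@le_trans _ _ (dot x eta + d)); last first.
  by rewrite -lerBrDl; apply: ximin; rewrite inE.
rewrite lerD2l mulrAC ler_pdivrMr// ler_wpM2l ?(ltW d0)//.
rewrite (le_trans (ler_norm _))// (le_trans (dot_le_norm _ _))//.
by rewrite mulrA ler_wpDr// ler_piMr ?sphere_norm_le1// mulr_ge0.
Qed.

End convex_body_theory.

(** * Lebesgue measure on tuples *)

Section lebesgue_tuple_theory.
Context {R : realType}.
Local Notation RR := (measurableTypeR R).

Lemma lebesgue_tupleS n (A : set (n.+1.-tuple RR)) :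
  lebesgue_tuple n.+1 A = ((lebesgue_measure \x lebesgue_tuple n)
    [set p : RR * n.-tuple RR | A [tuple of p.1 :: p.2]])%E.
Proof. by []. Qed.

Lemma measurable_tuple_cons n (A : set (n.+1.-tuple RR)) : measurable A ->
  measurable [set p : RR * n.-tuple RR | A [tuple of p.1 :: p.2]].
Proof.
move=> mA; have : measurable_fun setT
  (fun p : RR * n.-tuple RR => [tuple of p.1 :: p.2]) by exact: measurable_cons.
by move=> /(_ measurableT _ mA); rewrite setTI.
Qed.

(** Fubini along axis [k]. The recursive definition of the measure peels off coordinate 0; any other
    axis is reached by induction inside the slices. *)
Lemma lebesgue_tuple_thin n (k : 'I_n) (A : set (n.-tuple RR)) : measurable A ->
  (forall t u, A t -> A u -> (forall i, i != k -> tnth t i = tnth u i) ->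
    tnth t k = tnth u k) ->
  lebesgue_tuple n A = 0%E.
Proof.
elim: n k A => [[]//|n IH] k A mA thin.
have mB := measurable_tuple_cons mA.
rewrite lebesgue_tupleS; set B := [set p | _] in mB *.
have [k0|[k' k'E]] : k = ord0 \/ exists k', k = lift ord0 k'.
  by case: (unliftP ord0 k) => [k' ->|->]; [right; exists k'|left].
(* The order of integration is exchanged, so that the inner integral runs along coordinate 0, where
   a slice has at most one point. *)
- rewrite (@product_measure_unique _ _ _ _ _ lebesgue_measure (lebesgue_tuple n)
    (lebesgue_measure \x^ lebesgue_tuple n)%E)//; last first.
    by move=> *; exact: product_measure2E.
  apply: integral0_eq => y _ /=.
  have [[x Bx]|/forallNP nB] := pselect (exists x, B (x, y)).
    apply: (@subset_measure0 _ _ _ _ _ [set x]) => //=.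
    + exact: measurable_ysection.
    + move=> z; rewrite /ysection /= inE => Bz.
      have := thin _ _ Bz Bx; rewrite k0 !tnth0; apply.
      move=> i; case: (unliftP ord0 i) => [j ->|->]; last by rewrite eqxx.
      by rewrite !tnthS.
    + exact: lebesgue_measure_set1.
  rewrite (_ : ysection B y = set0) ?measure0// -subset0 => z.
  by rewrite /ysection /= inE => /nB.
- apply: integral0_eq => x _ /=; apply: (IH k').
    exact: measurable_xsection.
  move=> t u; rewrite /xsection /= !inE => Bt Bu tu.
  have := thin _ _ Bt Bu; rewrite k'E !tnthS; apply.
  move=> i; case: (unliftP ord0 i) => [j ->|->]; last by rewrite !tnth0.
  by rewrite !tnthS => jk; apply: tu; apply: contraNneq jk => ->.
Qed.

Definition tuple_box n (I : 'I_n -> set R) : set (n.-tuple RR) :=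
  [set t | forall i, I i (tnth t i)].

Lemma measurable_tuple_box n (I : 'I_n -> set R) :
  (forall i, measurable (I i : set RR)) -> measurable (tuple_box I).
Proof.
move=> mI.
rewrite (_ : tuple_box I =
    \bigcap_(i in [set: 'I_n]) ((@tnth n RR)^~ i @^-1` I i)); last first.
  by apply/seteqP; split=> t /= H i; [move=> _; exact: H|exact: (H i)].
apply: fin_bigcap_measurable; first exact: finite_finset.
by move=> i _; have := measurable_tnth i measurableT (mI i); rewrite setTI.
Qed.

Lemma lebesgue_tuple_boxE n (I : 'I_n -> set R) :
  (forall i, measurable (I i : set RR)) ->
  lebesgue_tuple n (tuple_box I) = (\prod_(i < n) lebesgue_measure (I i : set RR))%E.
Proof.
elim: n I => [|n IH] I mI.
  rewrite big_ord0 /= (_ : tuple_box I = setT) ?diracT//.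
  by rewrite -subTset => t _ [].
rewrite lebesgue_tupleS big_ord_recl -IH//.
rewrite -product_measure1E//; last exact: measurable_tuple_box.
congr (product_measure1 _ _ _). apply/seteqP; split => -[x t] /=.
  by move=> H; split=> [|i]; [have := H ord0; rewrite tnth0|
    have := H (lift ord0 i); rewrite tnthS].
move=> [Hx Ht] i; case: (unliftP ord0 i) => [j ->|->]; last by rewrite tnth0.
by rewrite tnthS; exact: Ht.
Qed.

(** Relates the product sigma-algebra of tuples to the one generated by open sets: an open set is
    the union of the countably many cubes with rational centre and radius 1 / (k + 1) that it
    contains. *)
Lemma measurable_row_tuple m :
  measurable_fun [set: m.-tuple RR] (fun t => \row_i tnth t i : borel_rV R m).
Proof.
apply: (@measurability _ _ (m.-tuple RR) (borel_rV R m) _ _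
  [set U : set ('rV[R]_m) | open U]) => //.
move=> _ [U oU <-]; rewrite setTI.
pose box (z : {ffun 'I_m -> rat} * nat) : set ('rV[R]_m) :=
  [set x | forall i, `|x ord0 i - ratr (z.1 i)| < z.2.+1%:R^-1].
have -> : (fun t => \row_i tnth t i : borel_rV R m) @^-1` U =
   \bigcup_z (if `[< box z `<=` U >] then [set t : m.-tuple RR |
     box z (\row_i tnth t i)] else set0).
  apply/seteqP; split => t /=.
    move=> Ut; have := oU; rewrite openE => /(_ _ Ut) /nbhs_ballP[e /= e0 eU].
    set x := (\row_i tnth t i) in eU Ut *.
    (* Any two points of a cube of radius below e / 2 are at distance less than [e]. *)
    have [k ke] : exists k : nat, k.+1%:R^-1 < e / 2.
      have := near_infty_natSinv_lt (PosNum (divr_gt0 e0 (ltr0n R 2))).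
      by move=> [k _ /(_ k) /= H]; exists k; apply: H => /=.
    have [q qP] : {q : {ffun 'I_m -> rat} &
        forall i, `|x ord0 i - ratr (q i)| < k.+1%:R^-1}.
      have H i : {r : rat | `|x ord0 i - ratr r| < k.+1%:R^-1}.
        apply: cid; have : x ord0 i - k.+1%:R^-1 < x ord0 i + k.+1%:R^-1.
          by rewrite ltrD2l gtrN.
        move=> /rat_in_itvoo[r]; rewrite in_itv /= => /andP[r1 r2]; exists r.
        by rewrite ltr_distlC r1.
      exists [ffun i => projT1 (H i)] => i; rewrite ffunE; exact: (projT2 (H i)).
    exists (q, k) => //; rewrite ifT//.
    apply/asboolP => y By; apply: eU; split=> // i j; rewrite (ord1 i) -ball_normE /=.
    have := qP j; have := By j; rewrite /= => h1 h2.
    have -> : x ord0 j - y ord0 j = (x ord0 j - ratr (q j)) - (y ord0 j - ratr (q j)).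
      by lra.
    by rewrite (le_lt_trans (ler_normB _ _))// (splitr e) ltrD// (lt_trans _ ke).
  by move=> [z _]; case: ifPn => // /asboolP zU /= /zU.
apply: countable_bigcupT_measurable => // z; case: ifPn => // _.
rewrite (_ : mkset _ = tuple_box (fun i => `]ratr (z.1 i) - z.2.+1%:R^-1,
    ratr (z.1 i) + z.2.+1%:R^-1[%classic)); last first.
  by apply/seteqP; split=> t /= H i; move: (H i) => /=; rewrite mxE /= in_itv/= ltr_distl.
by apply: measurable_tuple_box => i; exact: measurable_itv.
Qed.

End lebesgue_tuple_theory.

(** * The measure of the sphere *)

Section sphere_measure_theory.
Context {R : realType} {m : nat}.
Local Notation RR := (measurableTypeR R).
Implicit Types (A : set 'rV[R]_m).

Definition normalize (x : 'rV[R]_m) := (Num.sqrt (dot x x))^-1 *: x.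

Lemma continuous_normalize x : x != 0 -> {for x, continuous normalize}.
Proof.
move=> x0; have cd : {for x, continuous (fun x : 'rV[R]_m => Num.sqrt (dot x x))}.
  apply: (@continuous_comp _ _ _ (fun x : 'rV[R]_m => dot x x) Num.sqrt).
    exact: (cvg_dot (@cvg_id _ (nbhs x)) (@cvg_id _ (nbhs x))).
  exact: sqrt_continuous.
have c0 : Num.sqrt (dot x x) != 0 by rewrite gt_eqF// sqrtr_gt0 dot_gt0.
exact: (cvgZ (cvgV c0 cd) (@cvg_id _ (nbhs x))).
Qed.

Lemma normalizeZ c x : 0 < c -> sphere x -> normalize (c *: x) = x.
Proof.
move=> c0 Sx; rewrite /normalize dotZl dotZr Sx mulr1 -expr2 sqrtr_sqr gtr0_norm//.
by rewrite scalerA mulVf ?scale1r// gt_eqF.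
Qed.

Lemma open_neq0 : open [set x : 'rV[R]_m | x != 0].
Proof.
have -> : [set x : 'rV[R]_m | x != 0] = ~` [set 0].
  by apply/seteqP; split=> x /= /eqP.
by apply: closed_openC; apply: accessible_closed_set1; apply: hausdorff_accessible;
  exact: norm_hausdorff.
Qed.

Lemma open_normalize_preimage (U : set 'rV[R]_m) : open U ->
  open [set x | x != 0 /\ U (normalize x)].
Proof.
move=> oU; rewrite openE => x [x0 Ux]; rewrite /interior.
have : nbhs (normalize x) U by rewrite openE in oU; exact: oU.
move=> /(continuous_normalize x0) H.
by apply: filterI => //; have := open_neq0; rewrite openE => /(_ _ x0).
Qed.

Lemma measurable_open (U : set (borel_rV R m)) :
  open (U : set 'rV[R]_m) -> measurable U.
Proof. exact: sub_sigma_algebra. Qed.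

Lemma measurable_closed (U : set (borel_rV R m)) :
  closed (U : set 'rV[R]_m) -> measurable U.
Proof.
by move=> cU; rewrite -(setCK U); apply: measurableC;
  apply: measurable_open; exact: closed_openC.
Qed.

Lemma measurable_normalize : measurable_fun
  ([set x | x != 0] : set (borel_rV R m)) (normalize : borel_rV R m -> borel_rV R m).
Proof.
apply: (@measurability _ _ (borel_rV R m) (borel_rV R m) _ _
  [set U : set ('rV[R]_m) | open U]) => //.
by move=> _ [U oU <-]; apply: measurable_open; exact: open_normalize_preimage.
Qed.

Lemma closed_sphere : closed (sphere : set 'rV[R]_m).
Proof. apply: compact_closed; [exact: norm_hausdorff|exact: sphere_compact]. Qed.

Lemma continuous_sqdot : continuous (fun x : 'rV[R]_m => dot x x).
Proof. by move=> x; exact: (cvg_dot (@cvg_id _ (nbhs x)) (@cvg_id _ (nbhs x))). Qed.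

(** As a preimage under [normalize], the cone gets its measurability from continuity away from the
    origin. *)
Lemma coneE A : cone (A `&` sphere) =
  [set x | dot x x <= 1] `&` ([set x | x != 0] `&` normalize @^-1` A).
Proof.
apply/seteqP; split=> x /=.
  move=> [r [theta [/andP[r0 r1] [Ath St] ->]]].
  rewrite normalizeZ// dotZl dotZr St mulr1; split.
    by rewrite mulr_ile1// ltW.
  by split=> //; rewrite scaler_eq0 gt_eqF//= sphere_neq0.
move=> [x1 [x0 Ax]]; exists (Num.sqrt (dot x x)), (normalize x); split.
- by rewrite sqrtr_gt0 dot_gt0 x0/= -sqrtr1 ler_sqrt.
- by split=> //; exact: normalize_sphere.
- exact: normalizeK.
Qed.

Lemma measurable_cone A : borel A ->
  measurable ([set t | cone (A `&` sphere) (\row_i tnth t i)] : set (m.-tuple RR)).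
Proof.
move=> mA; have := @measurable_row_tuple R m measurableT.
move=> /(_ (cone (A `&` sphere) : set (borel_rV R m))); rewrite setTI; apply.
rewrite coneE; apply: measurableI.
  apply: measurable_closed; apply: (closed_le_fun (v := cst 1)).
    exact: continuous_sqdot.
  by move=> ?; exact: cst_continuous.
apply: measurable_normalize => //.
by apply: measurable_open; exact: open_neq0.
Qed.

Lemma sphere_measureE A : borel A -> sphere_measure (A : set sphere_type) =
  (m%:R%:E * lebesgue_tuple m
    ([set t | cone (A `&` sphere) (\row_i tnth t i)] : set (m.-tuple RR)))%E.
Proof.
move=> mA; rewrite /sphere_measure /sphere_outer_measure measurable_mu_extE//.
exact: measurable_cone.
Qed.

(** The Caratheodory criterion is inherited from Lebesgue outer measure: a nonzero vector has a
    single direction, so taking cones commutes with intersections and differences of parts of the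
    sphere. *)
Lemma measurable_borel A : borel A -> measurable (A : set (@sphere_type R m)).
Proof.
move=> mA; apply: le_caratheodory_measurable => X.
rewrite /= /sphere_outer_measure -ge0_muleDr; [|exact: outer_measure_ge0..].
apply: lee_wpmul2l; first by rewrite lee_fin ler0n.
have := caratheodory_measurable_mu_ext (lebesgue_tuple m) (measurable_cone mA).
move=> /(_ [set t | cone (X `&` sphere) (\row_i tnth t i)]) => ->.
apply: leeD; apply: le_outer_measure => t /=;
  move=> [r [theta [r01 [[Xt At] St] tE]]].
  by split; exists r, theta.
split; first by exists r, theta.
have /andP[r0 _] := r01.
rewrite coneE => -[_ [_]] /=; rewrite tE normalizeZ//; exact: At.
Qed.

Lemma measurable_sphere_null (A B : set (@sphere_type R m)) :
  measurable B -> sphere_measure B = 0%E -> A `<=` B -> measurable A.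
Proof.
by move=> mB B0 AB; apply: (@measure_is_complete_caratheodory R _
  (@sphere_outer_measure R m)); exists B.
Qed.

Lemma measurable_sphere : measurable (sphere : set (@sphere_type R m)).
Proof. by apply: measurable_borel; apply: measurable_closed; exact: closed_sphere. Qed.

Lemma sphere_measure_fin : (sphere_measure (sphere : set (@sphere_type R m)) < +oo)%E.
Proof.
rewrite sphere_measureE; last by apply: measurable_closed; exact: closed_sphere.
apply: lte_mul_pinfty; rewrite ?lee_fin ?ler0n//.
pose I (i : 'I_m) : set R := `[-1, 1]%classic.
have mI i : measurable (I i : set RR) by exact: measurable_itv.
apply: (@le_lt_trans _ _ (lebesgue_tuple m (tuple_box I))).
  apply: le_measure; rewrite ?inE.
  - by apply: measurable_cone; apply: measurable_closed; exact: closed_sphere.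
  - exact: measurable_tuple_box.
  - move=> t [r [theta [/andP[r0 r1] [St _] tE]]] i; rewrite /I /= in_itv/= -ler_norml.
    have -> : tnth t i = (r *: theta) ord0 i by rewrite -tE mxE.
    rewrite mxE normrM gtr0_norm// mulr_ile1 ?(ltW r0)//.
    by rewrite (le_trans (coord_le_norm _ _))// sphere_norm_le1.
rewrite lebesgue_tuple_boxE// (eq_bigr (fun=> 2%:E)).
  by rewrite prodEFin ltry.
move=> i _; rewrite [LHS]lebesgue_measure_itv/= lte_fin ifT; last by lra.
by rewrite -EFinB; congr (_%:E); lra.
Qed.

Lemma lebesgue_tuple_open_gt0 (U : set 'rV[R]_m) : open U -> U !=set0 ->
  (0 < lebesgue_tuple m ([set t | U (\row_i tnth t i)] : set (m.-tuple RR)))%E.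
Proof.
move=> oU [x Ux]; have := oU; rewrite openE => /(_ _ Ux) /nbhs_ballP[e /= e0 eU].
pose I i : set R := `]x ord0 i - e, x ord0 i + e[%classic.
have mI i : measurable (I i : set RR) by exact: measurable_itv.
apply: (@lt_le_trans _ _ (lebesgue_tuple m (tuple_box I))).
  rewrite lebesgue_tuple_boxE// (eq_bigr (fun=> (e + e)%:E)).
    by rewrite prodEFin lte_fin prodr_gt0// => *; rewrite addr_gt0.
  move=> i _; rewrite [LHS]lebesgue_measure_itv/= lte_fin ifT; last by lra.
  by rewrite -EFinB; congr (_%:E); lra.
apply: le_measure; rewrite ?inE.
- exact: measurable_tuple_box.
- by have := @measurable_row_tuple R m measurableT _ (measurable_open oU); rewrite setTI.
- move=> t tI; apply: eU; split=> // i j; rewrite (ord1 i) -ball_normE /= mxE ltr_distlC.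
  by have := tI j; rewrite /I /= in_itv.
Qed.

Lemma sphere_measure_open_gt0 (U : set 'rV[R]_m) : (0 < m)%N -> open U ->
  U `&` sphere !=set0 -> (0 < sphere_measure (U : set sphere_type))%E.
Proof.
move=> m0 oU [xi [Uxi Sxi]].
rewrite sphere_measureE; last exact: measurable_open.
rewrite mule_gt0 ?lte_fin ?ltr0n//.
(* An open part of the cone over [U]; the strict inequality discards the points of radius 1. *)
pose V := [set x | x != 0 /\ U (normalize x)] `&` [set x | dot x x < 1].
have oV : open V.
  apply: openI; first exact: open_normalize_preimage.
  apply: (open_lt_fun (v := cst 1)); first exact: continuous_sqdot.
  by move=> ?; exact: cst_continuous.
have V0 : V !=set0.
  exists (2^-1 *: xi); split; first split.
  - by rewrite scaler_eq0 invr_eq0 pnatr_eq0/= sphere_neq0.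
  - by rewrite normalizeZ.
  - by rewrite /= dotZl dotZr Sxi; lra.
apply: (lt_le_trans (lebesgue_tuple_open_gt0 oV V0)).
apply: le_measure; rewrite ?inE.
- by have := @measurable_row_tuple R m measurableT _ (measurable_open oV); rewrite setTI.
- by apply: measurable_cone; exact: measurable_open.
- by move=> t [[t0 Ut] t1]; rewrite /= coneE; split=> //=; exact: ltW.
Qed.

(* Each [F i] is null by Fubini along the axis [k i], whose lines it meets at
   most once. *)
Lemma sphere_measure_thin A (I : countType) (F : I -> set 'rV[R]_m)
    (k : I -> 'I_m) :
  borel A -> (forall i, borel (F i)) ->
  (forall i x y, F i x -> F i y -> (forall j, j != k i -> x ord0 j = y ord0 j) ->
    x ord0 (k i) = y ord0 (k i)) ->
  cone (A `&` sphere) `<=` \bigcup_i F i -> sphere_measure (A : set sphere_type) = 0%E.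
Proof.
move=> mA mF thin AF; rewrite sphere_measureE//.
set T := [set t | _].
suff -> : lebesgue_tuple m T = 0%E by rewrite mule0.
pose G i : set (m.-tuple RR) := [set t | F i (\row_j tnth t j)].
have mG i : measurable (G i).
  by have := @measurable_row_tuple R m measurableT _ (mF i); rewrite setTI.
have G0 i : lebesgue_tuple m (G i) = 0%E.
  apply: (@lebesgue_tuple_thin R m (k i)) => // t u Gt Gu tu.
  have := thin i _ _ Gt Gu; rewrite !mxE; apply => j jk; rewrite !mxE; exact: tu.
have : (lebesgue_tuple m).-negligible (\bigcup_i G i).
  pose H n := if unpickle n is Some i then G i else set0.
  apply: (@negligibleS _ _ _ _ (\bigcup_n H n)).
    by move=> t [i _ Gt]; exists (pickle i) => //; rewrite /H pickleK.
  apply: negligible_bigcup => n; rewrite /H.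
  by case: unpickle => [i|]; [apply/negligibleP => //; exact: G0|exact: negligible_set0].
move=> [N [mN N0 GN]].
apply: (@subset_measure0 _ _ _ _ _ N) => //; first exact: measurable_cone.
by move=> t /AF [i _ Fi]; apply: GN; exists i.
Qed.

End sphere_measure_theory.

(** * The inverse Gauss map *)

(** Tube lemma. It makes closed the sets of normals that are described by the existence of suitable
    points in a compact body. *)
Lemma closed_proj_compact {T U : topologicalType} (K : set U) (P : set (T * U)) :
  compact K -> closed P -> closed [set t | exists2 u, K u & P (t, u)].
Proof.
move=> /compact_near_coveringP cK cP.
rewrite -[X in closed X]setCK; apply: open_closedC; rewrite openE => t /= nP.
have H := cK _ (nbhs t) (fun t' u => ~ P (t', u)) _.
have : \forall t' \near t, K `<=` (fun u => ~ P (t', u)).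
  apply: H => u Ku; have : ~ P (t, u) by move=> Pu; apply: nP; exists u.
  move=> nPu; have : nbhs (t, u) (~` P).
    by have := closed_openC cP; rewrite openE; exact.
  move=> [[V W] /= [Vt Wu] VW]; exists (W, V) => //= -[u' t'] [/= Wu' Vt'].
  exact: (VW (t', u')).
by apply: filterS => t' KP [u Ku Pu]; exact: (KP u).
Qed.

Lemma measurable_fun_ge {d} {T : measurableType d} {R : realType} (D : set T)
    (u : T -> measurableTypeR R) :
  (forall r, measurable (D `&` [set x | r <= u x])) -> measurable_fun D u.
Proof.
move=> H; apply: (measurability (@measurable_realfun.RGenCInfty.G R)).
  exact: measurable_realfun.RGenCInfty.measurableE.
move=> _ [_ [r ->] <-]; have := H r; congr measurable.
by apply/seteqP; split=> x [Dx] /=; rewrite in_itv/= andbT.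
Qed.

Section gauss_map.
Context {R : realType} {m : nat} (K : set 'rV[R]_m).
Hypotheses (Kbody : convex_body K) (Kint0 : K° 0).
Local Notation RR := (measurableTypeR R).
Local Notation V := 'rV[R]_m.
Local Notation h := (support K).
Local Notation rho := (radial K).
Implicit Types (x y xi theta : 'rV[R]_m) (A E F : set 'rV[R]_m).

Let cont_dot {T : topologicalType} (f g : T -> V) :
  continuous f -> continuous g -> continuous (fun t => dot (f t) (g t)).
Proof. by move=> cf cg t; exact: (cvg_dot (@cf t) (@cg t)). Qed.

Let cont_h {T : topologicalType} (f : T -> V) :
  continuous f -> continuous (fun t => h (f t)).
Proof.
move=> cf t; apply: (@continuous_comp _ _ _ f h); first exact: cf.
exact: continuous_support.
Qed.

Let cont_coord {T : topologicalType} (f : T -> V) i :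
  continuous f -> continuous (fun t => f t ord0 i).
Proof.
move=> cf t; apply: (@continuous_comp _ _ _ f (fun x => x ord0 i)); first exact: cf.
exact: coord_continuous.
Qed.

Let cont_fst {T U : topologicalType} : continuous (@fst T U).
Proof. by move=> ?; exact: cvg_fst. Qed.

Let cont_snd {T U : topologicalType} : continuous (@snd T U).
Proof. by move=> ?; exact: cvg_snd. Qed.

Lemma inv_gauss_dot_gt0 xi theta : inv_gauss K xi theta -> 0 < dot theta xi.
Proof.
move=> /(inv_gaussP Kbody Kint0)[Sx St E].
have := support_gt0 Kbody Kint0 (sphere_neq0 Sx).
by rewrite -E pmulr_rgt0// radial_gt0.
Qed.

(** With [inv_gauss_face], identifies the face of [K] in direction [xi] with [inv_gauss K xi]
    through [normalize]. Faces are easier to handle: they are cut out of a compact set by closed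
    conditions. *)
Lemma face_inv_gauss xi x : sphere xi -> K x -> dot x xi = h xi ->
  inv_gauss K xi (normalize x) /\ rho (normalize x) *: normalize x = x.
Proof.
move=> Sxi Kx xE; have h0 := support_gt0 Kbody Kint0 (sphere_neq0 Sxi).
have x0 : x != 0.
  by apply: contraTneq h0 => x0; rewrite -xE x0 dot0l ltxx.
have Sx := normalize_sphere x0.
have rE : rho (normalize x) = Num.sqrt (dot x x).
  apply/eqP; rewrite eq_le; apply/andP; split; last first.
    by apply: radial_ge => //; rewrite -normalizeK.
  have d0 : 0 < dot (normalize x) xi.
    by rewrite dotZl xE mulr_gt0// invr_gt0 sqrtr_gt0 dot_gt0.
  rewrite -(ler_pM2r d0) (le_trans (radial_dot_le Kbody Kint0 Sx xi))//.
  by rewrite -dotZl -normalizeK// xE.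
have E : rho (normalize x) *: normalize x = x by rewrite rE -normalizeK.
by split=> //; apply/inv_gaussP => //; split=> //; rewrite -dotZl E.
Qed.

Lemma inv_gauss_face xi theta : inv_gauss K xi theta ->
  [/\ K (rho theta *: theta), dot (rho theta *: theta) xi = h xi &
      normalize (rho theta *: theta) = theta].
Proof.
move=> /(inv_gaussP Kbody Kint0)[Sx St E]; split.
- exact: radial_body.
- by rewrite dotZl.
- by rewrite normalizeZ// radial_gt0.
Qed.

(** The unit vectors at which the inverse Gauss map is multivalued, that is, at which the support
    function is not differentiable. *)
Definition singular_normals : set V :=
  [set xi | sphere xi /\ exists theta1 theta2,
    [/\ inv_gauss K xi theta1, inv_gauss K xi theta2 & theta1 != theta2]].
Local Notation N := singular_normals.

(* Directions whose face has width at least [b - a] along the axis [i]: by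
   monotonicity of the faces, a line parallel to that axis meets this set at
   most once. *)
Definition wide_face (i : 'I_m) (a b : R) : set V :=
  [set xi | exists2 z : V * V, (K `*` K) z &
    [/\ dot z.1 xi = h xi, dot z.2 xi = h xi, z.1 ord0 i <= a & b <= z.2 ord0 i]].

Lemma closed_wide_face i a b : closed (wide_face i a b).
Proof.
have [cK _ _] := Kbody.
apply: (@closed_proj_compact _ _ (K `*` K) [set t : V * (V * V) |
  [/\ dot t.2.1 t.1 = h t.1, dot t.2.2 t.1 = h t.1, t.2.1 ord0 i <= a &
      b <= t.2.2 ord0 i]]); first exact: compact_setX.
have c1 : continuous (fun t : V * (V * V) => t.1) by exact: cont_fst.
have c2 : continuous (fun t : V * (V * V) => t.2.1).
  by move=> t; apply: (@continuous_comp _ _ _ snd fst); [exact: cont_snd|exact: cont_fst].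
have c3 : continuous (fun t : V * (V * V) => t.2.2).
  by move=> t; apply: (@continuous_comp _ _ _ snd snd); [exact: cont_snd|exact: cont_snd].
have cc (r : R) : continuous (fun _ : V * (V * V) => r).
  by move=> ?; exact: cst_continuous.
have -> : [set t : V * (V * V) | [/\ dot t.2.1 t.1 = h t.1,
    dot t.2.2 t.1 = h t.1, t.2.1 ord0 i <= a & b <= t.2.2 ord0 i]] =
   [set t : V * (V * V) | dot t.2.1 t.1 = h t.1] `&`
   [set t : V * (V * V) | dot t.2.2 t.1 = h t.1] `&`
   [set t : V * (V * V) | t.2.1 ord0 i <= a] `&`
   [set t : V * (V * V) | b <= t.2.2 ord0 i].
  by apply/seteqP; split=> t /=; [move=> []|move=> [[[]]]].
apply: closedI; first apply: closedI; first apply: closedI.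
- exact: (closed_eq_fun (cont_dot c2 c1) (cont_h c1)).
- exact: (closed_eq_fun (cont_dot c3 c1) (cont_h c1)).
- apply: (@closed_le_fun R _ (fun t : V * (V * V) => t.2.1 ord0 i) (cst a)).
    exact: (@cont_coord _ (fun t : V * (V * V) => t.2.1) i).
  exact: cc.
- apply: (@closed_le_fun R _ (cst b) (fun t : V * (V * V) => t.2.2 ord0 i)).
    exact: cc.
  exact: (@cont_coord _ (fun t : V * (V * V) => t.2.2) i).
Qed.

Lemma wide_face_thin i a b xi eta : a < b -> wide_face i a b xi ->
  wide_face i a b eta -> (forall j, j != i -> xi ord0 j = eta ord0 j) ->
  xi ord0 i = eta ord0 i.
Proof.
move=> ab.
have main xi' eta' : wide_face i a b xi' -> wide_face i a b eta' ->
    (forall j, j != i -> xi' ord0 j = eta' ord0 j) -> eta' ord0 i <= xi' ord0 i.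
  move=> [[x1 x2] /= [Kx1 Kx2] [x1E x2E x1a bx2]].
  move=> [[y1 y2] /= [Ky1 Ky2] [y1E y2E y1a by2]] ij.
  rewrite leNgt; apply/negP => lt.
  (* Each point is extremal for its own normal. In the sum of the two inequalities only coordinate
     [i] survives, and there [y1] is at most [a] while [x2] is at least [b]. *)
  have h1 : dot y1 xi' <= dot x2 xi' by rewrite x2E dot_le_support.
  have h2 : dot x2 eta' <= dot y1 eta' by rewrite y1E dot_le_support.
  have : dot (y1 - x2) (eta' - xi') >= 0.
    by rewrite dotBr !dotBl; lra.
  rewrite /dot (bigD1 i)//= big1 ?addr0; last first.
    by move=> j ji; rewrite !mxE ij// subrr mulr0.
  rewrite !mxE pmulr_lge0 ?subr_gt0// leNgt => /negP; apply; lra.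
move=> Wx We ij; apply/eqP; rewrite eq_le !main// => j ji.
by rewrite ij.
Qed.

Let index := ('I_m * (rat * rat))%type.

(** Rational bounds keep the family countable; degenerate pairs give the empty set because thinness
    requires a gap between the bounds. *)
Let wide (z : index) : set V :=
  if z.2.1 < z.2.2 then wide_face z.1 (ratr z.2.1) (ratr z.2.2) else set0.

Let closed_wide z : closed (wide z).
Proof. by rewrite /wide; case: ifP => _; [exact: closed_wide_face|exact: closed0]. Qed.

Let wideZ z c xi : 0 < c -> wide z xi -> wide z (c *: xi).
Proof.
move=> c0; rewrite /wide; case: ifP => // _ [[x y] Kxy [/= xE yE xa yb]].
by exists (x, y) => //; split=> //=; rewrite dotZr (supportZ Kbody Kint0) ?ltW ?xE ?yE.
Qed.

(** Two distinct points of a face differ in some coordinate, and two rationals fit strictly between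
    the two values. The singular normals are thus a countable union of closed sets. *)
Lemma singular_normalsE : N = \bigcup_z (wide z `&` sphere).
Proof.
apply/seteqP; split=> xi.
  move=> [Sxi [t1 [t2 [/inv_gauss_face[Kx xE xn] /inv_gauss_face[Ky yE yn] t12]]]].
  move: (_ *: t1) (_ *: t2) Kx xE xn Ky yE yn => x y Kx xE xn Ky yE yn.
  have /eqP xy : x != y by apply: contra_neq t12 => xy; rewrite -xn -yn xy.
  have [i /eqP xyi] : exists i, x ord0 i <> y ord0 i.
    by apply/existsNP; apply: contra_not xy => H; apply/rowP.
  have W u v : K u -> K v -> dot u xi = h xi -> dot v xi = h xi ->
      u ord0 i < v ord0 i -> (\bigcup_z (wide z `&` sphere)) xi.
    move=> Ku Kv uE vE uv.
    have [a] := rat_in_itvoo uv; rewrite in_itv/= => /andP[ua av].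
    have [b] := rat_in_itvoo av; rewrite in_itv/= => /andP[ab bv].
    exists (i, (a, b)) => //; split=> //.
    rewrite /wide /= -(ltr_rat R) ab; exists (u, v) => //; split=> //=; exact: ltW.
  by move: xyi; rewrite neq_lt => /orP[|] ?; [exact: (W x y)|exact: (W y x)].
move=> [[i [a b]] _ [+ Sxi]]; rewrite /wide /=; case: ifP => // ab.
move=> [[x y] [/= Kx Ky] [/= xE yE xa yb]]; split=> //.
have [G1 E1] := face_inv_gauss Sxi Kx xE.
have [G2 E2] := face_inv_gauss Sxi Ky yE.
exists (normalize x), (normalize y); split=> //.
apply/eqP => n12; have : x = y by rewrite -E1 -E2 n12.
move=> xy; have : ratr b <= (ratr a : R) by rewrite (le_trans yb)// -xy.
by rewrite ler_rat leNgt ab.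
Qed.

Lemma borel_singular_normals : borel N.
Proof.
rewrite singular_normalsE.
apply: (@countable_bigcupT_measurable _ (borel_rV R m)) => [|z]; first exact: countableP.
apply: measurable_closed; apply: closedI => //; exact: closed_sphere.
Qed.

Lemma sphere_measure_singular_normals :
  sphere_measure (N : set sphere_type) = 0%E.
Proof.
apply: (@sphere_measure_thin _ _ _ index wide (fun z => z.1)).
- exact: borel_singular_normals.
- by move=> z; apply: measurable_closed.
- move=> [i [a b]] x y; rewrite /wide /=; case: ifP => // ab.
  by apply: wide_face_thin; rewrite ltr_rat.
(* Fubini acts on the solid cone, so all radii must be covered; wide faces are invariant under
   positive scaling. *)
- move=> _ [r [theta [/andP[r0 _] [+ _] ->]]]; rewrite singular_normalsE.
  by move=> [z _ [Wz _]]; exists z => //; exact: wideZ.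
Qed.

(** The image is even compact: it is the image under [normalize] of the points of [K] that are
    extremal for some normal in [E], a compact set that avoids the origin. *)
Lemma borel_inv_gauss_image_closed E : closed E -> E `<=` sphere ->
  borel (inv_gauss_image K E).
Proof.
move=> cE ES; have [cK _ _] := Kbody.
pose C := [set x | exists2 xi, E xi & dot x xi = h xi] `&` K.
have cC : compact C.
  apply: (subclosed_compact _ cK); last by move=> x [].
  apply: closedI; last exact: body_closed.
  apply: (@closed_proj_compact _ _ E [set t : V * V | dot t.1 t.2 = h t.2]).
    by apply: (subclosed_compact cE) ES; exact: sphere_compact.
  exact: (closed_eq_fun (cont_dot cont_fst cont_snd) (cont_h cont_snd)).
have -> : inv_gauss_image K E = normalize @` C.
  apply/seteqP; split=> [theta [xi Exi /inv_gauss_face[Kx xE xn]]|].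
    by exists (rho theta *: theta) => //; split=> //; exists xi.
  move=> _ [x [[xi Exi xE] Kx] <-]; exists xi => //.
  by have [] := face_inv_gauss (ES _ Exi) Kx xE.
apply: measurable_closed; apply: compact_closed; first exact: norm_hausdorff.
apply: continuous_compact => //.
apply: continuous_in_subspaceT => x /set_mem [[xi Exi xE] Kx].
apply: continuous_normalize.
have := support_gt0 Kbody Kint0 (sphere_neq0 (ES _ Exi)).
by rewrite -xE; apply: contraTneq => ->; rewrite dot0l ltxx.
Qed.

Lemma borel_inv_gauss_singular : borel (inv_gauss_image K N).
Proof.
have -> : inv_gauss_image K N = \bigcup_z inv_gauss_image K (wide z `&` sphere).
  rewrite singular_normalsE; apply/seteqP; split=> theta.
    by move=> [xi [z _ zxi] H]; exists z => //; exists xi.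
  by move=> [z _ [xi zxi H]]; exists xi => //; exists z.
apply: (@countable_bigcupT_measurable _ (borel_rV R m)) => [|z]; first exact: countableP.
apply: borel_inv_gauss_image_closed; last exact: subIsetr.
by apply: closedI => //; exact: closed_sphere.
Qed.

Lemma inv_gauss_funP xi : sphere xi -> inv_gauss K xi (inv_gauss_fun K xi).
Proof. by move=> Sxi; apply: xgetPex; exact: inv_gauss_nonempty. Qed.

Lemma inv_gauss_fun_unique xi theta : sphere xi -> ~ N xi ->
  inv_gauss K xi theta -> theta = inv_gauss_fun K xi.
Proof.
move=> Sxi nN Ht; apply/eqP/negP => /negP neq; apply: nN; split=> //.
by exists theta, (inv_gauss_fun K xi); split=> //; exact: inv_gauss_funP.
Qed.

Let borel_sphereDN : borel (sphere `\` N).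
Proof.
apply: (@measurableD _ (borel_rV R m)); last exact: borel_singular_normals.
by apply: measurable_closed; exact: closed_sphere.
Qed.

Lemma measurable_inv_gauss_fun : measurable_fun
  (sphere `\` N : set (borel_rV R m)) (inv_gauss_fun K : borel_rV R m -> borel_rV R m).
Proof.
apply: (@measurability _ _ (borel_rV R m) (borel_rV R m) _ _
  [set U : set ('rV[R]_m) | open U]) => //.
move=> _ [U oU <-].
(* Including 0 makes [C] closed although [normalize] is not continuous there; it adds nothing,
   because the support function is positive and no face contains 0. *)
pose C : set V := [set x | x = 0 \/ ~ U (normalize x)].
have cC : closed C.
  have -> : C = ~` [set x | x != 0 /\ U (normalize x)].
    apply/seteqP; split=> x /=.
      by move=> [->|nU]; [rewrite eqxx => -[]|move=> []].
    by move=> /not_andP[/negP/negPn/eqP|]; [left|right].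
  by apply: open_closedC; exact: open_normalize_preimage.
(* At a regular normal the face has one point, so that some point of it lies in [C] exactly when the
   selected direction is outside [U]. *)
pose W := [set xi | exists2 x, K x & (dot x xi = h xi /\ C x)].
have cW : closed W.
  have [cK _ _] := Kbody.
  apply: (@closed_proj_compact _ _ K
    [set t : V * V | dot t.2 t.1 = h t.1 /\ C t.2]) => //.
  apply: (@closedI _ [set t : V * V | dot t.2 t.1 = h t.1] [set t : V * V | C t.2]).
    exact: (closed_eq_fun (cont_dot cont_snd cont_fst) (cont_h cont_fst)).
  by have /continuous_closedP := @cont_snd V V; exact.
rewrite [X in measurable X](_ : _ = (sphere `\` N) `\` W); last first.
  apply/seteqP; split=> xi /= [[Sxi nN]].
    move=> Uxi; split=> // -[x Kx [xE [x0|nU]]].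
      have := support_gt0 Kbody Kint0 (sphere_neq0 Sxi).
      by rewrite -xE x0 dot0l ltxx.
    by apply: nU; have [/(inv_gauss_fun_unique Sxi nN)-> _] := face_inv_gauss Sxi Kx xE.
  move=> nW; split=> //; apply: contra_notP nW => nU.
  have [Kx xE xn] := inv_gauss_face (inv_gauss_funP Sxi).
  by exists (rho (inv_gauss_fun K xi) *: inv_gauss_fun K xi) => //; split=> //; right;
    rewrite xn.
by apply: measurableD => //; exact: measurable_closed.
Qed.

Lemma measurable_radial :
  measurable_fun (sphere : set (borel_rV R m)) (rho : borel_rV R m -> RR).
Proof.
apply: measurable_fun_ge => r.
have [r0|r0] := leP r 0.
  rewrite (_ : _ `&` _ = sphere).
    by apply: measurable_closed; exact: closed_sphere.
  apply/seteqP; split=> x [] // Sx; split=> //=.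
  by rewrite (le_trans r0)// ltW// radial_gt0.
rewrite (_ : _ `&` _ = sphere `&` [set x | K (r *: x)]).
  apply: measurable_closed; apply: closedI; first exact: closed_sphere.
  have /continuous_closedP : continuous (fun x : V => r *: x).
    by move=> x; exact: (cvgZ (cvg_cst r) (@cvg_id _ (nbhs x))).
  by apply; exact: body_closed.
by apply/seteqP; split=> x [Sx] /=; move/(radial_leP Kbody Kint0 Sx (ltW r0)).
Qed.

Lemma measurable_support : measurable_fun [set: borel_rV R m] (h : borel_rV R m -> RR).
Proof.
apply: measurable_fun_ge => r; rewrite setTI; apply: measurable_closed.
apply: (closed_le_fun (u := cst r)); first by move=> ?; exact: cst_continuous.
exact: continuous_support.
Qed.

End gauss_map.

(** * Transport by the inverse Gauss map *)

Section layers.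
Context {R : realType} {d1 d2} {T1 : measurableType d1} {T2 : measurableType d2}.
Context (mu1 : {measure set T1 -> \bar R}) (mu2 : {measure set T2 -> \bar R}).
Context (D1 : set T1) (D2 : set T2) (w1 a1 : T1 -> R) (w2 a2 : T2 -> R).

Local Notation layer D a c d := (D `&` [set x | c <= a x < d]).

Lemma measurable_layer {d} {T : measurableType d} (D : set T) (a : T -> R) c e :
  measurable D -> measurable_fun D a -> measurable (layer D a c e).
Proof.
move=> mD ma; have := ma mD `[c, e[%classic (measurable_itv _).
by congr measurable; apply/seteqP; split=> x [Dx] /=; rewrite in_itv.
Qed.

Lemma layers_cover {T : Type} (D : set T) (a : T -> R) e : 0 < e ->
  (forall x, D x -> 0 <= a x) ->
  \bigcup_k (layer D a (e *+ k) (e *+ k.+1)) = D.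
Proof.
move=> e0 a0; apply/seteqP; split=> [x [k _ []]//|x Dx].
have ae : 0 <= a x / e by rewrite divr_ge0 ?a0// ltW.
exists (Num.truncn (a x / e)) => //; split=> //=.
rewrite -!(mulr_natr e) ![e * _]mulrC -ler_pdivlMr// -ltr_pdivrMr//.
exact: truncn_itv.
Qed.

Lemma layers_trivIset {T : Type} (D : set T) (a : T -> R) e : 0 < e ->
  trivIset [set: nat] (fun k => layer D a (e *+ k) (e *+ k.+1)).
Proof.
move=> e0; apply/trivIsetP => i j _ _ ij; rewrite -subset0 => x.
move=> [[_ /andP[i1 i2]] [_ /andP[j1 j2]]]; move: ij.
have lt k l : e *+ k <= a x -> a x < e *+ l.+1 -> (k <= l)%N.
  by move=> h1 h2; have := le_lt_trans h1 h2; rewrite ltr_pMn2l.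
by rewrite eqn_leq (lt _ _ i1 j2) (lt _ _ j1 i2).
Qed.

Hypotheses (mD1 : measurable D1) (mD2 : measurable D2).
Hypotheses (mw1 : measurable_fun D1 w1) (ma1 : measurable_fun D1 a1).
Hypotheses (mw2 : measurable_fun D2 w2) (ma2 : measurable_fun D2 a2).
Hypotheses (w1_ge0 : forall x, D1 x -> 0 <= w1 x).
Hypotheses (a1_ge0 : forall x, D1 x -> 0 <= a1 x).
Hypotheses (w2_ge0 : forall x, D2 x -> 0 <= w2 x).
Hypotheses (a2_ge0 : forall x, D2 x -> 0 <= a2 x).
Local Open Scope ereal_scope.

(** On the layer where both functions lie between k e and (k + 1) e, the left integral is at most (k
    + 1) e times the common mass and the right one at least k e times it. The total error is e times
    the total mass, which is finite. *)
Lemma integral_layers_le :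
  \int[mu1]_(x in D1) (w1 x)%:E < +oo ->
  (forall c d, \int[mu1]_(x in layer D1 a1 c d) (w1 x)%:E =
               \int[mu2]_(x in layer D2 a2 c d) (w2 x)%:E) ->
  \int[mu1]_(x in D1) (w1 x * a1 x)%:E <= \int[mu2]_(x in D2) (w2 x * a2 x)%:E.
Proof.
move=> fin lay.
set G := \int[mu1]_(x in D1) (w1 x)%:E in fin.
have G0 : 0 <= G by apply: integral_ge0 => x Dx; rewrite lee_fin w1_ge0.
have Gfin : G \is a fin_num by rewrite ge0_fin_numE.
apply/lee_addgt0Pr => eps eps0.
(* Chosen so that [e] times the total mass is at most [eps]; the added 1 covers a total mass of
   zero. *)
pose e := (eps / (fine G + 1))%R.
have g1 : (0 < fine G + 1)%R by rewrite ltr_wpDl// fine_ge0.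
have e0 : (0 < e)%R by rewrite divr_gt0.
pose F1 k := layer D1 a1 (e *+ k)%R (e *+ k.+1)%R.
pose F2 k := layer D2 a2 (e *+ k)%R (e *+ k.+1)%R.
have mF1 k : measurable (F1 k) by exact: measurable_layer.
have mF2 k : measurable (F2 k) by exact: measurable_layer.
have U1 : \bigcup_k F1 k = D1 by exact: layers_cover.
have U2 : \bigcup_k F2 k = D2 by exact: layers_cover.
have F1D k : F1 k `<=` D1 by move=> x [].
have F2D k : F2 k `<=` D2 by move=> x [].
have mwa1 : measurable_fun D1 (fun x => (w1 x * a1 x)%:E).
  by apply/measurable_EFinP; exact: measurable_funM.
have mwa2 : measurable_fun D2 (fun x => (w2 x * a2 x)%:E).
  by apply/measurable_EFinP; exact: measurable_funM.
have mW1 : measurable_fun D1 (fun x => (w1 x)%:E) by exact/measurable_EFinP.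
have mW2 : measurable_fun D2 (fun x => (w2 x)%:E) by exact/measurable_EFinP.
pose g k := \int[mu1]_(x in F1 k) (w1 x)%:E.
have g0 k : 0 <= g k.
  by apply: integral_ge0 => x /F1D Dx; rewrite lee_fin w1_ge0.
have GE : G = \sum_(k <oo) g k.
  by rewrite /G -{1}U1 ge0_integral_bigcup ?U1//; exact: layers_trivIset.
have e0' k : (0 <= e *+ k)%R by rewrite mulrn_wge0// ltW.
have L1 k : \int[mu1]_(x in F1 k) (w1 x * a1 x)%:E <= (e *+ k)%:E * g k + e%:E * g k.
  rewrite -ge0_muleDl ?lee_fin// ?(ltW e0)// -EFinD -mulrSr.
  rewrite /g -ge0_integralZl//; last 3 first.
  - exact: measurable_funS mD1 (@F1D k) mW1.
  - by move=> x /F1D Dx; rewrite lee_fin w1_ge0.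
  - by rewrite lee_fin.
  apply: ge0_le_integral => //.
  - by move=> x /F1D Dx; rewrite lee_fin mulr_ge0 ?w1_ge0 ?a1_ge0.
  - exact: measurable_funS mD1 (@F1D k) mwa1.
  - by apply: measurable_funeM; exact: measurable_funS mD1 (@F1D k) mW1.
  - move=> x [Dx /andP[_ ax]]; rewrite -EFinM lee_fin mulrC.
    by rewrite ler_wpM2r ?w1_ge0// ltW.
have L2 k : (e *+ k)%:E * g k <= \int[mu2]_(x in F2 k) (w2 x * a2 x)%:E.
  rewrite /g lay -/(F2 k) -ge0_integralZl//; last 3 first.
  - exact: measurable_funS mD2 (@F2D k) mW2.
  - by move=> x /F2D Dx; rewrite lee_fin w2_ge0.
  - by rewrite lee_fin.
  apply: ge0_le_integral => //.
  - by move=> x /F2D Dx; rewrite -EFinM lee_fin mulr_ge0// w2_ge0.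
  - by apply: measurable_funeM; exact: measurable_funS mD2 (@F2D k) mW2.
  - exact: measurable_funS mD2 (@F2D k) mwa2.
  - move=> x [Dx /andP[ax _]]; rewrite -EFinM lee_fin mulrC.
    by rewrite ler_wpM2l ?w2_ge0.
have p0 x : D1 x -> 0 <= (w1 x * a1 x)%:E.
  by move=> Dx; rewrite lee_fin mulr_ge0 ?w1_ge0 ?a1_ge0.
have q0 x : D2 x -> 0 <= (w2 x * a2 x)%:E.
  by move=> Dx; rewrite lee_fin mulr_ge0 ?w2_ge0 ?a2_ge0.
rewrite -{1}U1 ge0_integral_bigcup ?U1//; last exact: layers_trivIset.
rewrite -{1}U2 ge0_integral_bigcup ?U2//; last exact: layers_trivIset.
apply: (@le_trans _ _ (\sum_(k <oo) ((e *+ k)%:E * g k + e%:E * g k))).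
  by apply: lee_nneseries => k _; [move=> _; apply: integral_ge0 => x /F1D /p0|].
rewrite nneseriesD; last 2 first.
- by move=> k _ _; rewrite mule_ge0// lee_fin.
- by move=> k _ _; rewrite mule_ge0// lee_fin ltW.
apply: leeD.
  by apply: lee_nneseries => k _; [move=> _; rewrite mule_ge0// lee_fin|].
rewrite nneseriesZl//.
rewrite -GE -(fineK Gfin) -EFinM lee_fin /e mulrAC ler_pdivrMr//.
by rewrite ler_wpM2l ?(ltW eps0)// lerDl.
Qed.

End layers.

Section transport.
Context {R : realType} {m : nat} (K : set 'rV[R]_m).
Hypotheses (Kbody : convex_body K) (Kint0 : K° 0).
Context (p q : R) (f g : 'rV[R]_m -> R).
Local Notation RR := (measurableTypeR R).
Local Notation V := 'rV[R]_m.
Local Notation mu := (@sphere_measure R m).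
Local Notation h := (support K).
Local Notation rho := (radial K).
Local Notation th := (inv_gauss_fun K).
Local Notation N := (singular_normals K).
Hypotheses (f_meas :
  measurable_fun (sphere : set (@sphere_type R m)) (f : sphere_type -> RR))
  (f_ge0 : forall xi, sphere xi -> 0 <= f xi)
  (g_meas : measurable_fun (sphere : set (borel_rV R m)) (g : borel_rV R m -> RR))
  (g_gt0 : forall theta, sphere theta -> 0 < g theta)
  (g_fin : (\int[mu]_(theta in sphere) (g theta)%:E < +oo)%E)
  (Ksol : generalized_solution p q f g K).

Lemma measurable_fun_borel (D : set V) {d} {T : sigmaRingType d} (u : V -> T) :
  borel D -> measurable_fun (D : set (borel_rV R m)) (u : borel_rV R m -> T) ->
  measurable_fun (D : set (@sphere_type R m)) (u : sphere_type -> T).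
Proof. by move=> bD mu _ Y mY; apply: measurable_borel; exact: mu. Qed.

Let b xi := f xi * h xi `^ p * rho (th xi) `^ (- q).

Let S' : set V := sphere `\` N.

Let borel_sphere : borel (sphere : set V).
Proof. by apply: measurable_closed; exact: closed_sphere. Qed.

Let bN : borel N := borel_singular_normals Kbody Kint0.

Let bS' : borel S'.
Proof. exact: (@measurableD _ (borel_rV R m)). Qed.

Let mS' : measurable (S' : set (@sphere_type R m)).
Proof. exact: measurable_borel. Qed.

Let b_ge0 xi : sphere xi -> 0 <= b xi.
Proof. by move=> Sxi; rewrite !mulr_ge0 ?powR_ge0// f_ge0. Qed.

Let th_sphere xi : sphere xi -> sphere (th xi).
Proof. by move=> /(inv_gauss_funP Kbody Kint0) []. Qed.

Lemma measurable_inv_gauss_comp (u : V -> R) :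
  measurable_fun (sphere : set (borel_rV R m)) (u : borel_rV R m -> RR) ->
  measurable_fun (sphere `\` N : set (@sphere_type R m)) (u \o th : sphere_type -> RR).
Proof.
move=> mu; apply: measurable_fun_borel => //.
apply: (@measurable_comp _ _ _ (borel_rV R m) (borel_rV R m) RR sphere) => //.
  by move=> _ [xi [Sxi _] <-]; exact: th_sphere.
exact: measurable_inv_gauss_fun.
Qed.

Lemma measurable_density : measurable_fun (sphere `\` N : set (@sphere_type R m))
  (fun xi : sphere_type => f xi * h xi `^ p * rho (th xi) `^ (- q) : RR).
Proof.
apply: measurable_funM; first apply: measurable_funM.
- by apply: measurable_funS f_meas; [exact: measurable_sphere|move=> ? []].
- apply: (measurableT_comp (measurable_powR p)).
  apply: measurable_fun_borel => //.
  exact: measurable_funS (measurable_support Kbody Kint0).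
- apply: (measurableT_comp (measurable_powR (- q))).
  exact: (measurable_inv_gauss_comp (measurable_radial Kbody Kint0)).
Qed.

Let mg : measurable_fun (sphere : set (@sphere_type R m)) (fun x => (g x)%:E).
Proof. by apply/measurable_EFinP; exact: measurable_fun_borel. Qed.

(** In the equation with [N] as test set, the right side vanishes because [N] is null; since [g] is
    positive, the image on the left must be null. *)
Lemma sphere_measure_inv_gauss_singular : mu (inv_gauss_image K N) = 0%E.
Proof.
have N0 := sphere_measure_singular_normals Kbody Kint0.
have mI : measurable (inv_gauss_image K N : set (@sphere_type R m)).
  by apply: measurable_borel; exact: borel_inv_gauss_singular.
have IS : inv_gauss_image K N `<=` sphere by move=> theta [xi _ []].
have NS : N `<=` sphere by move=> xi [].
have mNy : measurable (N : set (@sphere_type R m)) by exact: measurable_borel.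
(* The selection is arbitrary on [N], but the measure is complete, so any function is measurable on
   a null set. *)
have mbN : measurable_fun (N : set (@sphere_type R m))
    (fun xi => (f xi * h xi `^ p * rho (th xi) `^ (- q))%:E).
  move=> _ Y _; apply: (measurable_sphere_null mNy N0) => x; exact: (@subIsetl _ _ _ x).
have := Ksol bN NS; rewrite (null_set_integral mNy mbN N0).
have mgI : measurable_fun (inv_gauss_image K N : set (@sphere_type R m))
  (fun x => (g x)%:E).
  by apply: measurable_funS mg => //; exact: measurable_sphere.
rewrite (eq_integral (fun x : @sphere_type R m => `|(g x)%:E|%E)); last first.
  by move=> x; rewrite inE => /IS Sx; rewrite gee0_abs// lee_fin ltW// g_gt0.
move/(ae_eq_integral_abs mu mI mgI) => [Z [mZ Z0 HZ]].
apply: (subset_measure0 mI mZ _ Z0) => x Ix; apply: HZ => /= H.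
by have := g_gt0 (IS _ Ix); have [->] := H Ix; rewrite ltxx.
Qed.

(** Turns the equation from sets of normals to sets of directions. Every direction in [F] has some
    normal; unless this normal is singular, the selection sends it back to the direction. Hence [F]
    and the image of its preimage agree off a null set. *)
Lemma transport_set (F : set V) : borel F -> F `<=` sphere ->
  (\int[mu]_(theta in F) (g theta)%:E =
   \int[mu]_(xi in S' `&` th @^-1` F) (b xi)%:E)%E.
Proof.
move=> bF FS.
have bE : borel (S' `&` th @^-1` F).
  exact: (measurable_inv_gauss_fun Kbody Kint0 bS' bF).
have ES : S' `&` th @^-1` F `<=` sphere by move=> x [[]].
rewrite -(Ksol bE ES).
set I := inv_gauss_image K _; set Z := inv_gauss_image K N.
have Z0 := sphere_measure_inv_gauss_singular.
have bZ : borel Z := borel_inv_gauss_singular Kbody Kint0.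
have mZ : measurable (Z : set (@sphere_type R m)) by exact: measurable_borel.
have mF : measurable (F : set (@sphere_type R m)) by exact: measurable_borel.
have IF : I `<=` F.
  move=> theta [xi [[Sxi nN] Fxi] H].
  by rewrite (inv_gauss_fun_unique Kbody Kint0 Sxi nN H).
have DE : F `\` Z = I `\` Z.
  apply/seteqP; split=> theta [H nZ]; split=> //; last exact: IF.
  have [xi Hxi] := gauss_nonempty Kbody Kint0 (FS _ H).
  have Sxi : sphere xi by have [] := (inv_gaussP Kbody Kint0 xi theta).1 Hxi.
  have nN : ~ N xi by move=> Nxi; apply: nZ; exists xi.
  exists xi => //; split=> //.
  by rewrite /preimage /mkset -(inv_gauss_fun_unique Kbody Kint0 Sxi nN Hxi).
(* [I] is the union of the Borel set [F] minus [Z] and a subset of the null set [Z], measurable by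
   completeness. *)
have mI : measurable (I : set (@sphere_type R m)).
  rewrite -(setUIDK I Z); apply: measurableU.
    by apply: (measurable_sphere_null mZ Z0); exact: subIsetr.
  by rewrite -DE; exact: measurableD.
have g0 x : sphere x -> (0 <= (g x)%:E)%E by move=> Sx; rewrite lee_fin ltW// g_gt0.
have negl (A : set V) : measurable (A : set (@sphere_type R m)) -> A `<=` sphere ->
    (\int[mu]_(theta in A) (g theta)%:E = \int[mu]_(theta in A `\` Z) (g theta)%:E)%E.
  move=> mA AS.
  have mgA : measurable_fun (A : set (@sphere_type R m)) (fun x => (g x)%:E).
    exact: measurable_funS measurable_sphere AS mg.
  exact: (ge0_negligible_integral mZ mA mgA (fun x Ax => g0 x (AS x Ax)) Z0).
by rewrite (negl F)// DE -(negl I)//; exact: subset_trans FS.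
Qed.

Lemma transport (a : V -> R) :
  measurable_fun (sphere : set (borel_rV R m)) (a : borel_rV R m -> RR) ->
  (forall theta, sphere theta -> 0 <= a theta) ->
  (\int[mu]_(theta in sphere) (g theta * a theta)%:E =
   \int[mu]_(xi in S') (b xi * a (th xi))%:E)%E.
Proof.
move=> ma a0.
have S'S : S' `<=` sphere by move=> x [].
have lay (c d : R) : (\int[mu]_(x in sphere `&` [set x | (c <= a x < d)%R]) (g x)%:E =
    \int[mu]_(x in S' `&` [set x | (c <= (a \o th) x < d)%R]) (b x)%:E)%E.
  rewrite transport_set; last by move=> x [].
    congr (integral _ _ _); apply/seteqP; split=> x [Sx] /=; first by case.
    by move=> cd; split=> //; split=> //; exact/th_sphere/S'S.
  exact: (measurable_layer c d _ ma).
have fin2 : (\int[mu]_(x in S') (b x)%:E < +oo)%E.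
  suff <- : (\int[mu]_(x in sphere) (g x)%:E = \int[mu]_(x in S') (b x)%:E)%E by [].
  rewrite transport_set//; congr (integral _ _ _); apply/seteqP; split=> x //=.
    by case.
  by move=> Sx; split=> //; exact/th_sphere/S'S.
(* The layer comparison is one-sided, but its hypothesis is symmetric: it is used in both
   directions. *)
apply/eqP; rewrite eq_le; apply/andP; split.
- apply: (@integral_layers_le _ _ _ _ _ mu mu sphere S' g a b (a \o th)) => //.
  + exact: measurable_sphere.
  + exact: measurable_fun_borel.
  + exact: measurable_fun_borel.
  + exact: measurable_density.
  + exact: (measurable_inv_gauss_comp ma).
  + by move=> x /g_gt0/ltW.
  + by move=> x /S'S/b_ge0.
  + by move=> x /S'S/th_sphere/a0.
- apply: (@integral_layers_le _ _ _ _ _ mu mu S' sphere b (a \o th) g a) => //.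
  + exact: measurable_sphere.
  + exact: measurable_density.
  + exact: (measurable_inv_gauss_comp ma).
  + exact: measurable_fun_borel.
  + exact: measurable_fun_borel.
  + by move=> x /S'S/b_ge0.
  + by move=> x /S'S/th_sphere/a0.
  + by move=> x /g_gt0/ltW.
Qed.

End transport.

(** * Functions with a common logarithmic subgradient *)

(* [beta] is a common subgradient of [ln u] and [ln v]. *)
Lemma log_subgradient_ratio_cst {R : realType} (u v beta : R -> R) (B C : R) :
  (forall t, 0 <= t <= 1 -> 0 < u t) -> (forall t, 0 <= t <= 1 -> 0 < v t) ->
  (forall t, 0 <= t <= 1 -> `|beta t| <= B) ->
  (forall t, 0 <= t <= 1 -> u t / v t <= C) ->
  (forall s t, 0 <= s <= 1 -> 0 <= t <= 1 -> u t * (1 + (s - t) * beta t) <= u s) ->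
  (forall s t, 0 <= s <= 1 -> 0 <= t <= 1 -> v t * (1 + (s - t) * beta t) <= v s) ->
  u 1 / v 1 = u 0 / v 0.
Proof.
move=> u0 v0 bB rC uu vv; pose r t := u t / v t.
have I0 : 0 <= (0 : R) <= 1 by rewrite lexx ler01.
have I1 : 0 <= (1 : R) <= 1 by rewrite lexx ler01.
have r0 t : 0 <= t <= 1 -> 0 < r t by move=> t01; rewrite divr_gt0 ?u0 ?v0.
have B0 : 0 <= B := le_trans (normr_ge0 _) (bB 0 I0).
have C0 : 0 < C := lt_le_trans (r0 0 I0) (rC 0 I0).
(* The first-order error is an increment of [beta], which telescopes over a subdivision, so that no
   regularity of [beta] beyond its bound is required. The condition on d B keeps the factors below
   positive. *)
have step t d : 0 <= t <= 1 -> 0 <= t + d <= 1 -> 0 <= d -> d * B < 1 ->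
    `|r (t + d) - r t| <= C * (d * (beta (t + d) - beta t) + d ^+ 2 * B ^+ 2).
  move=> t01 s01 d0 dB; set s := t + d in s01 *.
  have st : s - t = d by rewrite /s addrC addKr.
  have ts : t - s = - d by rewrite -st opprB.
  have /ler_normlP[bs1 bs2] := bB s s01; have /ler_normlP[bt1 bt2] := bB t t01.
  have dbs : - (d * B) <= d * beta s <= d * B.
    by rewrite -mulrN !ler_wpM2l//= lerNl.
  have dbt : - (d * B) <= d * beta t <= d * B.
    by rewrite -mulrN !ler_wpM2l//= lerNl.
  have p1 : 0 < 1 - d * beta s by lra.
  have p2 : 0 < 1 + d * beta t by lra.
  (* Multiplying an inequality for [u] by the opposite one for [v] bounds each of [r s] and [r t]
     below by [k] times the other. Hence k <= 1, and both differences are at most C (1 - k). *)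
  pose k := (1 - d * beta s) * (1 + d * beta t).
  have k0 : 0 < k by rewrite mulr_gt0.
  have := uu s t s01 t01; rewrite st => us.
  have := uu t s t01 s01; rewrite ts mulNr => ut.
  have := vv s t s01 t01; rewrite st => vs.
  have := vv t s t01 s01; rewrite ts mulNr => vt.
  have [ut0 us0 vt0 vs0] : [/\ 0 < u t, 0 < u s, 0 < v t & 0 < v s].
    by rewrite !u0 ?v0.
  have ks : k * r s <= r t.
    rewrite /r mulrA ler_pdivrMr// [leRHS]mulrAC ler_pdivlMr//.
    have := ler_pM (mulr_ge0 (ltW us0) (ltW p1)) (mulr_ge0 (ltW vt0) (ltW p2)) ut vs.
    by apply: le_trans; rewrite le_eqVlt; apply/orP; left; apply/eqP; rewrite /k; ring.
  have kt : k * r t <= r s.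
    rewrite /r mulrA ler_pdivrMr// [leRHS]mulrAC ler_pdivlMr//.
    have := ler_pM (mulr_ge0 (ltW ut0) (ltW p2)) (mulr_ge0 (ltW vs0) (ltW p1)) us vt.
    by apply: le_trans; rewrite le_eqVlt; apply/orP; left; apply/eqP; rewrite /k; ring.
  have k1 : k <= 1.
    rewrite leNgt; apply/negP => k1.
    have h1 : r s < k * r s by rewrite ltr_pMl ?r0.
    have h2 : r t < k * r t by rewrite ltr_pMl ?r0.
    by move: (lt_le_trans h1 ks) (lt_le_trans h2 kt); lra.
  have eta : 1 - k <= d * (beta s - beta t) + d ^+ 2 * B ^+ 2.
    have : d ^+ 2 * (beta s * beta t) <= d ^+ 2 * B ^+ 2.
      apply: ler_wpM2l; first exact: sqr_ge0.
      rewrite (le_trans (ler_norm _))// normrM expr2 ler_pM//; exact: bB.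
    by rewrite /k; lra.
  apply: (@le_trans _ _ (C * (1 - k))); last by rewrite ler_wpM2l// ltW.
  have bnd x y : 0 < x -> x <= C -> k * x <= y -> x - y <= C * (1 - k).
    move=> x0 xC kxy; apply: (@le_trans _ _ (x * (1 - k))); first by lra.
    by rewrite ler_wpM2r// subr_ge0.
  by rewrite ler_norml lerNl opprB !bnd ?r0 ?rC.
(* Telescoped over all N + 1 steps, the bound becomes C (beta 1 - beta 0 + B^2) / (N + 1), which
   tends to 0. *)
have sum N k : (k <= N.+1)%N -> B < N.+1%:R ->
    `|r (k%:R / N.+1%:R) - r 0| <= C * (N.+1%:R^-1 * (beta (k%:R / N.+1%:R) - beta 0)
       + k%:R * (N.+1%:R^-1 ^+ 2 * B ^+ 2)).
  move=> + BN; have N0 : 0 < N.+1%:R :> R by [].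
  elim: k => [_|k IH kN].
    by rewrite !mul0r !subrr normr0 mulr0 addr0 mulr0.
  have T01 j : (j <= N.+1)%N -> 0 <= (j%:R / N.+1%:R : R) <= 1.
    by move=> jN; rewrite divr_ge0//= ler_pdivrMr// mul1r ler_nat.
  have kS : k.+1%:R / N.+1%:R = k%:R / N.+1%:R + N.+1%:R^-1 :> R.
    by rewrite -natr1 mulrDl mul1r.
  have := step (k%:R / N.+1%:R) N.+1%:R^-1 (T01 k (ltnW kN)).
  rewrite -kS => /(_ (T01 _ kN)); rewrite invr_ge0 mulrC ltr_pdivrMr// mul1r.
  move=> /(_ (ltW N0) BN) H1; have := IH (ltnW kN).
  set x := k%:R / _ in H1 *; set y := k.+1%:R / _ in H1 *.
  move: (N.+1%:R^-1) H1 => d H1 H2.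
  rewrite (_ : r y - r 0 = (r y - r x) + (r x - r 0)); last by ring.
  apply: (le_trans (ler_normD _ _)); apply: (le_trans (lerD H1 H2)).
  by rewrite -mulrDr -natr1 le_eqVlt; apply/orP; left; apply/eqP; ring.
apply/eqP; rewrite -subr_eq0 -normr_eq0 -/(r 1) -/(r 0) eq_le normr_ge0 andbT.
rewrite leNgt; apply/negP => e0; set e := `|_| in e0.
have M0 : 0 < C * (2 * B + B ^+ 2) + 1.
  by rewrite ltr_wpDl// mulr_ge0 ?(ltW C0)// addr_ge0 ?mulr_ge0// sqr_ge0.
(* The first bound makes the step admissible. The second contradicts the telescoped estimate, in
   which the difference of the values of [beta] is at most 2 B. *)
have [N NB] : exists N : nat, Num.max B ((C * (2 * B + B ^+ 2) + 1) / e) < N.+1%:R.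
  by exists (Num.bound (Num.max B ((C * (2 * B + B ^+ 2) + 1) / e))).-1;
   apply: (lt_le_trans (archi_boundP _)); rewrite ?le_max ?B0// ler_nat -ltnS;
     case: (Num.bound _).
move: NB; rewrite gt_max => /andP[NB Ne].
have := sum N N.+1 (leqnn _) NB; rewrite divff ?pnatr_eq0// -/e.
have N0 : 0 < N.+1%:R :> R by [].
move: Ne; rewrite ltr_pdivrMr// => Ne He.
have /ler_normlP[b1 b2] := bB 1 I1; have /ler_normlP[b3 b4] := bB 0 I0.
have : e * N.+1%:R <= C * (2 * B + B ^+ 2).
  have Nd : N.+1%:R^-1 * N.+1%:R = 1 :> R by rewrite mulVf.
  have := ler_wpM2r (ltW N0) He; move/le_trans; apply.
  move: (N.+1%:R : R) (N.+1%:R^-1 : R) Nd => x y yx.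
  rewrite (_ : _ * x = C * (beta 1 - beta 0 + B ^+ 2)).
    by rewrite ler_wpM2l ?(ltW C0)// lerD2r; lra.
  rewrite -mulrA mulrDl; congr (_ * (_ + _)).
    by rewrite mulrAC yx mul1r.
  rewrite (_ : _ * x = (y * x) ^+ 2 * B ^+ 2); last by ring.
  by rewrite yx expr1n mul1r.
by rewrite mulrC => H; have := lt_le_trans Ne H; rewrite gtrDl ltr10.
Qed.

Lemma ge0_integral_le_ae_eq {R : realType} {d} {T : measurableType d}
    (mu : {measure set T -> \bar R}) (D : set T) (u v : T -> R) :
  measurable D -> measurable_fun D u -> measurable_fun D v ->
  (forall x, D x -> 0 <= u x <= v x) ->
  (\int[mu]_(x in D) (v x)%:E <= \int[mu]_(x in D) (u x)%:E)%E ->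
  (\int[mu]_(x in D) (u x)%:E < +oo)%E ->
  exists Z, [/\ measurable Z, mu Z = 0%E & forall x, D x -> ~ Z x -> u x = v x].
Proof.
move=> mD muf mvf uv vu ufin.
have mw : measurable_fun D (fun x => v x - u x) by exact: measurable_funB.
have mwE : measurable_fun D (fun x => (v x - u x)%:E) by exact/measurable_EFinP.
have muE : measurable_fun D (fun x => (u x)%:E) by exact/measurable_EFinP.
have u0 x : D x -> (0 <= (u x)%:E)%E by move=> /uv /andP[]; rewrite lee_fin.
have w0 x : D x -> (0 <= (v x - u x)%:E)%E.
  by move=> /uv /andP[]; rewrite lee_fin subr_ge0.
have vE : (\int[mu]_(x in D) (v x)%:E =
    \int[mu]_(x in D) (u x)%:E + \int[mu]_(x in D) (v x - u x)%:E)%E.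
  rewrite -ge0_integralD//; apply: eq_integral => x _.
  by rewrite -EFinD addrC subrK.
have I0 : (0 <= \int[mu]_(x in D) (u x)%:E)%E by exact: integral_ge0.
have J0 : (0 <= \int[mu]_(x in D) (v x - u x)%:E)%E by exact: integral_ge0.
have Ifin : (\int[mu]_(x in D) (u x)%:E)%E \is a fin_num by rewrite ge0_fin_numE.
have W0 : (\int[mu]_(x in D) `|(v x - u x)%:E| = 0)%E.
  rewrite (eq_integral (fun x => (v x - u x)%:E)); last first.
    by move=> x; rewrite inE => /w0 wx; rewrite gee0_abs.
  apply/eqP; rewrite eq_le J0 andbT.
  by move: vu; rewrite vE -[X in (_ <= X)%E]adde0 leeD2lE.
have /(ae_eq_integral_abs mu mD mwE)[Z [mZ Z0 HZ]] := W0.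
exists Z; split=> // x Dx nZ; apply/eqP; rewrite eq_sym -subr_eq0; apply/eqP.
apply: contrapT => H; apply: nZ; apply: HZ => /= /(_ Dx) [] ; exact: H.
Qed.

(** * Lipschitz and bounded functions on the sphere *)

Section lipschitz_sphere.
Context {R : realType} {m : nat} (g : 'rV[R]_m -> R).
Hypothesis g_lip : [lipschitz g x | x in sphere].

Lemma lipschitz_sphereP : exists2 k, 0 <= k &
  forall x y, sphere x -> sphere y -> g x <= g y + k * `|x - y|.
Proof.
have [M [_ HM]] := g_lip.
exists (`|M| + 1); first by rewrite addr_ge0.
move=> x y Sx Sy; rewrite -lerBlDl (le_trans (ler_norm _))//.
apply: (HM _ _ (x, y)) => //=.
by rewrite (le_lt_trans (ler_norm M))// ltrDl.
Qed.

(** [g] is controlled on the sphere only. There it is the infimum of the cones g y + k |x - y|, as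
    in the McShane extension, which makes its superlevel sets closed. *)
Lemma measurable_lipschitz_sphere : measurable_fun
  (sphere : set (borel_rV R m)) (g : borel_rV R m -> measurableTypeR R).
Proof.
have [k k0 gk] := lipschitz_sphereP.
apply: measurable_fun_ge => r.
rewrite [X in measurable X](_ : _ = sphere `&`
    \bigcap_(y in sphere) [set x : ('rV[R]_m) | r <= g y + k * `|x - y|]); last first.
  apply/seteqP; split=> x [Sx] /=.
    by move=> rx; split=> // y Sy; rewrite /= (le_trans rx)// gk.
  by move=> /(_ x Sx); rewrite /= subrr normr0 mulr0 addr0.
apply: measurable_closed; apply: closedI; first exact: closed_sphere.
apply: closed_bigI => y Sy.
apply: (@closed_le_fun R _ (cst r) (fun x : ('rV[R]_m) => g y + k * `|x - y|)) => x.
  exact: cst_continuous.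
have cn : (fun z : 'rV[R]_m => `|z - y|) @ x --> `|x - y|.
  exact: (cvg_norm (cvgB (@cvg_id _ (nbhs x)) (cvg_cst y))).
exact: (cvgD (cvg_cst (g y)) (cvgM (cvg_cst k) cn)).
Qed.

Lemma lipschitz_sphere_bounded : exists M, forall x, sphere x -> g x <= M.
Proof.
have [k k0 gk] := lipschitz_sphereP.
have [[y Sy]|nS] := pselect (exists y : 'rV[R]_m, sphere y); last first.
  by exists 0 => x Sx; case: nS; exists x.
exists (g y + k * 2) => x Sx; rewrite (le_trans (gk x y Sx Sy))// lerD2l.
rewrite ler_wpM2l// (le_trans (ler_normB _ _))//.
by rewrite (_ : 2 = 1 + 1 :> R)// lerD// sphere_norm_le1.
Qed.

End lipschitz_sphere.

Lemma integral_sphere_fin {R : realType} {m : nat} (u : 'rV[R]_m -> R) (M : R) :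
  measurable_fun (sphere : set (@sphere_type R m))
    (u : sphere_type -> measurableTypeR R) ->
  (forall x, sphere x -> 0 <= u x <= M) ->
  (\int[@sphere_measure R m]_(x in sphere) (u x)%:E < +oo)%E.
Proof.
move=> mu uM.
have mS := @measurable_sphere R m.
apply: (@le_lt_trans _ _ (`|M|%:E * @sphere_measure R m sphere)%E); last first.
  by apply: lte_mul_pinfty; rewrite ?lee_fin//; exact: sphere_measure_fin.
rewrite -(integral_cst _ mS).
have u0 (x : @sphere_type R m) : sphere x -> (0 <= (u x)%:E)%E.
  by move=> /uM /andP[]; rewrite lee_fin.
have muE : measurable_fun (sphere : set (@sphere_type R m)) (fun x => (u x)%:E).
  exact/measurable_EFinP.
apply: (ge0_le_integral _ mS u0 muE (measurable_cst _)) => x /uM /andP[_ xM].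
by rewrite lee_fin (le_trans xM)// ler_norm.
Qed.

(** * Inclusion, dilation and parallel faces of two bodies *)

Section two_bodies.
Context {R : realType} {m : nat} (K1 K2 : set 'rV[R]_m).
Hypotheses (K1_body : convex_body K1) (K2_body : convex_body K2).
Hypotheses (K1_0 : K1° 0) (K2_0 : K2° 0).
Local Notation V := 'rV[R]_m.

Lemma body_subset : (forall xi, sphere xi -> support K1 xi <= support K2 xi) ->
  K1 `<=` K2.
Proof.
move=> H x Kx; apply: body_separation => // xi Sxi.
by rewrite (le_trans _ (H _ Sxi))// dot_le_support.
Qed.

Lemma body_scale c : 0 < c ->
  (forall xi, sphere xi -> support K1 xi = c * support K2 xi) ->
  K1 = [set c *: x | x in K2].
Proof.
move=> c0 H; apply/seteqP; split=> x.
  move=> Kx; exists (c^-1 *: x); last by rewrite scalerA divff ?scale1r// gt_eqF.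
  apply: body_separation => // xi Sxi; rewrite dotZl ler_pdivrMl//.
  by rewrite -H// dot_le_support.
move=> [y Ky <-]; apply: body_separation => // xi Sxi.
by rewrite dotZl H// ler_wpM2l ?(ltW c0)// dot_le_support.
Qed.

(* That is, [ln (support K1)] and [ln (support K2)] have a common subgradient
   at [xi]. *)
Definition parallel_faces : set V :=
  [set xi | exists2 z : V * V, (K1 `*` K2) z &
    [/\ dot z.1 xi = support K1 xi, dot z.2 xi = support K2 xi &
        support K2 xi *: z.1 = support K1 xi *: z.2]].

Lemma closed_parallel_faces : closed parallel_faces.
Proof.
have [cK1 _ _] := K1_body; have [cK2 _ _] := K2_body.
pose w (t : V * (V * V)) : V := support K2 t.1 *: t.2.1 - support K1 t.1 *: t.2.2.
apply: (@closed_proj_compact _ _ (K1 `*` K2) [set t : V * (V * V) |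
  [/\ dot t.2.1 t.1 = support K1 t.1, dot t.2.2 t.1 = support K2 t.1 &
      support K2 t.1 *: t.2.1 = support K1 t.1 *: t.2.2]]); first exact: compact_setX.
rewrite (_ : mkset _ =
   [set t : V * (V * V) | dot t.2.1 t.1 = support K1 t.1] `&`
   [set t : V * (V * V) | dot t.2.2 t.1 = support K2 t.1] `&`
   [set t : V * (V * V) | dot (w t) (w t) = 0]); last first.
  apply/seteqP; split=> t /=.
    by move=> [? ? e]; split=> //; rewrite /w e subrr dot0l.
  move=> [[? ?] /eqP]; rewrite dot_eq0 subr_eq0 => /eqP ?; by split.
have c1 : continuous (fun t : V * (V * V) => t.1) by move=> ?; exact: cvg_fst.
have c2 : continuous (fun t : V * (V * V) => t.2.1).
  by move=> t; apply: (@continuous_comp _ _ _ snd fst); [exact: cvg_snd|exact: cvg_fst].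
have c3 : continuous (fun t : V * (V * V) => t.2.2).
  by move=> t; apply: (@continuous_comp _ _ _ snd snd); [exact: cvg_snd|exact: cvg_snd].
have s1 : continuous (fun t : V * (V * V) => support K1 t.1).
  move=> t; apply: (@continuous_comp _ _ _ fst (support K1)); first exact: cvg_fst.
  exact: continuous_support.
have s2 : continuous (fun t : V * (V * V) => support K2 t.1).
  move=> t; apply: (@continuous_comp _ _ _ fst (support K2)); first exact: cvg_fst.
  exact: continuous_support.
have cw t : w @ t --> w t.
  exact: (cvgB (cvgZ (@s2 t) (@c2 t)) (cvgZ (@s1 t) (@c3 t))).
apply: closedI; first apply: closedI.
- by apply: closed_eq_fun => // t; exact: (cvg_dot (@c2 t) (@c1 t)).
- by apply: closed_eq_fun => // t; exact: (cvg_dot (@c3 t) (@c1 t)).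
- apply: (@closed_eq_fun R _ (fun t => dot (w t) (w t)) (cst 0)) => t.
    exact: (cvg_dot (cw t) (cw t)).
  exact: cst_continuous.
Qed.

Lemma parallel_facesZ c xi : 0 < c -> parallel_faces xi -> parallel_faces (c *: xi).
Proof.
move=> c0 [z Kz [z1 z2 zE]]; exists z => //.
rewrite !dotZr z1 z2 !supportZ ?(ltW c0)//; split=> //.
by rewrite -!scalerA zE.
Qed.

Lemma common_inv_gauss_parallel xi theta :
  inv_gauss K1 xi theta -> inv_gauss K2 xi theta -> parallel_faces xi.
Proof.
move=> H1 H2.
have [Kx xE _] := inv_gauss_face K1_body K1_0 H1.
have [Ky yE _] := inv_gauss_face K2_body K2_0 H2.
exists (radial K1 theta *: theta, radial K2 theta *: theta) => //; split=> //=.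
rewrite -xE -yE !dotZl !scalerA; congr (_ *: _); ring.
Qed.

(** A point [x] of the face at z t gives h(z s) >= <x, z s>, which is affine in s and equals h(z t)
    at s = t. Divided by h(z t), its slope is a logarithmic subgradient along the segment, the same
    for both bodies when the faces are parallel. Avoiding the origin keeps both support functions
    positive. *)
Lemma support_ratio_segment xi eta :
  (forall zeta, sphere zeta -> parallel_faces zeta) ->
  (forall t, 0 <= t <= 1 -> xi + t *: (eta - xi) != 0) ->
  support K1 eta / support K2 eta = support K1 xi / support K2 xi.
Proof.
move=> par seg0.
pose z t : V := xi + t *: (eta - xi).
have parz t : 0 <= t <= 1 -> parallel_faces (z t).
  move=> t01; rewrite (@normalizeK _ _ (z t) (seg0 t t01)); apply: parallel_facesZ.
    by rewrite sqrtr_gt0 dot_gt0 seg0.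
  exact/par/normalize_sphere/seg0.
have cz : continuous z.
  move=> t; apply: (@cvgD _ _ _ (nbhs t)); first exact: cvg_cst.
  by apply: cvgZr_tmp; exact: (@cvg_id _ (nbhs t)).
have I01 : `[0 : R, 1]%classic !=set0 by exists 0; rewrite /= in_itv/= lexx ler01.
have segc (K : set V) : convex_body K -> K° 0 ->
    {within `[0 : R, 1]%classic, continuous (fun t => support K (z t))}.
  move=> Kb K0; apply: continuous_subspaceT => t.
  apply: (@continuous_comp _ _ _ z (support K)); first exact: cz.
  exact: continuous_support.
(* The extreme values along the segment provide the bounds on the slope and on the ratio. *)
have [t1 t1I t1min] := compact_EVT_min I01 (@segment_compact _ 0 1) (segc _ K1_body K1_0).
have [t2 t2I t2min] := compact_EVT_min I01 (@segment_compact _ 0 1) (segc _ K2_body K2_0).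
have [t3 t3I t3max] := compact_EVT_max I01 (@segment_compact _ 0 1) (segc _ K1_body K1_0).
have h1_gt0 t : 0 <= t <= 1 -> 0 < support K1 (z t).
  by move=> t01; apply: support_gt0 => //; exact: seg0.
have h2_gt0 t : 0 <= t <= 1 -> 0 < support K2 (z t).
  by move=> t01; apply: support_gt0 => //; exact: seg0.
have mem01 t : t \in `[0 : R, 1]%classic -> 0 <= t <= 1.
  by rewrite inE /= in_itv.
have in01 t : 0 <= t <= 1 -> t \in `[0 : R, 1]%classic.
  by rewrite inE /= in_itv.
have [M M0 KM] := body_bounded K1_body.
pose P t (x : V * V) := (K1 `*` K2) x /\
    [/\ dot x.1 (z t) = support K1 (z t), dot x.2 (z t) = support K2 (z t) &
        support K2 (z t) *: x.1 = support K1 (z t) *: x.2].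
pose x t := xget (0, 0) (P t).
have xP t : 0 <= t <= 1 -> P t (x t).
  by move=> t01; apply: xgetPex; have [y] := parz t t01; exists y.
pose beta t := dot (x t).1 (eta - xi) / support K1 (z t).
have beta2 t : 0 <= t <= 1 -> beta t = dot (x t).2 (eta - xi) / support K2 (z t).
  move=> t01; have [_ [_ _ E]] := xP t t01; rewrite /beta.
  have n1 : support K1 (z t) != 0 by rewrite gt_eqF// h1_gt0.
  have n2 : support K2 (z t) != 0 by rewrite gt_eqF// h2_gt0.
  apply/eqP; rewrite (eqr_div _ _ n1 n2); apply/eqP.
  by rewrite mulrC -dotZl E dotZl mulrC.
have zd s t : z s = z t + (s - t) *: (eta - xi).
  by apply/rowP => i; rewrite !mxE; ring.
have ext (a : R) (b : R) s t (y : V) : a != 0 -> dot y (z t) = a ->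
    a * (1 + (s - t) * (dot y (eta - xi) / a)) = dot y (z s).
  move=> a0 E; rewrite (zd s t) dotDr dotZr E; field; exact: a0.
have := @log_subgradient_ratio_cst R (fun t => support K1 (z t))
  (fun t => support K2 (z t)) beta
  (m%:R * (M * `|eta - xi|) / support K1 (z t1))
  (support K1 (z t3) / support K2 (z t2)) h1_gt0 h2_gt0.
have zE1 : z 1 = eta by rewrite /z scale1r addrC subrK.
have zE0 : z 0 = xi by rewrite /z scale0r addr0.
rewrite /= zE1 zE0; apply.
- move=> t t01; have [[K1x _] _] := xP t t01.
  rewrite normrM normfV (gtr0_norm (h1_gt0 t t01)).
  rewrite ler_pM// ?invr_ge0 ?(ltW (h1_gt0 t t01))//.
    rewrite (le_trans (dot_le_norm _ _))// ler_wpM2l// ler_wpM2r//; exact: KM.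
  have h1t1 := h1_gt0 _ (mem01 _ t1I).
  by rewrite lef_pV2 ?posrE ?(h1_gt0 t t01)//; apply: t1min; exact: in01.
- move=> t t01; rewrite ler_pM// ?invr_ge0 ?(ltW (h1_gt0 t t01)) ?(ltW (h2_gt0 t t01))//.
    by apply: t3max; exact: in01.
  have h2t2 := h2_gt0 _ (mem01 _ t2I).
  by rewrite lef_pV2 ?posrE ?(h2_gt0 t t01)//; apply: t2min; exact: in01.
- move=> s t s01 t01; have [[K1x _] [E _ _]] := xP t t01.
  rewrite /beta ext// ?gt_eqF ?h1_gt0//.
  exact: dot_le_support.
- move=> s t s01 t01; have [[_ K2x] [_ E _]] := xP t t01.
  rewrite (beta2 t t01) ext// ?gt_eqF ?h2_gt0//.
  exact: dot_le_support.
Qed.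

End two_bodies.

(** * Comparison of two solutions *)

Lemma measurable_fun_div_gt0 {R : realType} {d} {T : measurableType d} (D : set T)
    (u v : T -> measurableTypeR R) :
  (forall x, D x -> 0 < v x) -> measurable_fun D u -> measurable_fun D v ->
  measurable_fun D (fun x => u x / v x : measurableTypeR R).
Proof.
move=> v0 mu mv.
apply: (@eq_measurable_fun _ _ _ _ D (fun x => u x * v x `^ (-1))).
  by move=> x; rewrite inE => /v0/ltW Dx; rewrite powR_inv1.
apply: measurable_funM => //.
exact: (measurableT_comp (@measurable_powR R (-1))).
Qed.

(** The sign of [p] is unknown, so either endpoint may give the larger power; their sum serves in
    both cases. *)
Lemma powR_le_endpoints {R : realType} (p a b x : R) : 0 < a -> a <= x <= b ->
  x `^ p <= a `^ p + b `^ p.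
Proof.
move=> a0 /andP[ax xb]; have x0 := lt_le_trans a0 ax; have b0 := lt_le_trans x0 xb.
have [p0|p0] := leP 0 p.
  by rewrite ler_wpDl ?powR_ge0// ge0_ler_powR// nnegrE ltW.
rewrite ler_wpDr ?powR_ge0// -(opprK p) !(powRN _ (- p)).
rewrite lef_pV2 ?posrE ?powR_gt0//.
by rewrite ge0_ler_powR// ?nnegrE ?oppr_ge0 ltW.
Qed.

Lemma support_le_bound {R : realType} {m : nat} (K : set 'rV[R]_m) :
  convex_body K -> K° 0 ->
  exists M, forall xi, sphere xi -> support K xi <= M.
Proof.
move=> Kb K0; have [M M0 KM] := body_bounded Kb.
exists (m%:R * (M * 1)) => xi Sxi; apply: support_le => // x Kx.
rewrite (le_trans (ler_norm _))// (le_trans (dot_le_norm _ _))//.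
by rewrite ler_wpM2l// ler_pM ?KM// sphere_norm_le1.
Qed.

Section comparison.
Context {R : realType} {m : nat} (K1 K2 : set 'rV[R]_m).
Hypotheses (K1_body : convex_body K1) (K2_body : convex_body K2).
Hypotheses (K1_0 : K1° 0) (K2_0 : K2° 0).
Context (p q Lam : R) (f g : 'rV[R]_m -> R).
Local Notation RR := (measurableTypeR R).
Local Notation V := 'rV[R]_m.
Local Notation mu := (@sphere_measure R m).
Local Notation h1 := (support K1).
Local Notation h2 := (support K2).
Local Notation th1 := (inv_gauss_fun K1).
Local Notation th2 := (inv_gauss_fun K2).
Local Notation N1 := (singular_normals K1).
Local Notation N2 := (singular_normals K2).
Hypotheses
  (f_meas : measurable_fun (sphere : set (@sphere_type R m)) (f : sphere_type -> RR))
  (f_bnd : forall xi, sphere xi -> 0 < f xi <= Lam)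
  (g_gt0 : forall theta, sphere theta -> 0 < g theta)
  (g_lip : [lipschitz g x | x in sphere])
  (K1_sol : generalized_solution p q f g K1)
  (K2_sol : generalized_solution p q f g K2).

Definition support_ratio (xi : V) : R := h1 xi / h2 xi.
Definition radial_ratio (theta : V) : R := radial K1 theta / radial K2 theta.
Local Notation r := support_ratio.
Local Notation s := radial_ratio.

Lemma support_ratio_gt0 xi : sphere xi -> 0 < r xi.
Proof. by move=> /sphere_neq0 x0; rewrite divr_gt0 ?support_gt0. Qed.

Lemma radial_ratio_gt0 theta : sphere theta -> 0 < s theta.
Proof. by move=> St; rewrite divr_gt0 ?radial_gt0. Qed.

Lemma radial_ratio_le xi theta : inv_gauss K2 xi theta -> s theta <= r xi.
Proof.
move=> H; have [Sx St E] := (inv_gaussP K2_body K2_0 xi theta).1 H.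
have d0 := inv_gauss_dot_gt0 K2_body K2_0 H.
rewrite /s /r ler_pdivrMr ?radial_gt0// mulrAC ler_pdivlMr ?support_gt0 ?sphere_neq0//.
rewrite -E mulrA mulrAC ler_pM2r ?radial_gt0//.
exact: radial_dot_le.
Qed.

Lemma radial_ratio_ge xi theta : inv_gauss K1 xi theta -> r xi <= s theta.
Proof.
move=> H; have [Sx St E] := (inv_gaussP K1_body K1_0 xi theta).1 H.
have d0 := inv_gauss_dot_gt0 K1_body K1_0 H.
rewrite /s /r ler_pdivrMr ?support_gt0 ?sphere_neq0// mulrAC ler_pdivlMr ?radial_gt0//.
rewrite -E -mulrA ler_pM2l ?radial_gt0// mulrC.
exact: radial_dot_le.
Qed.

(** Multiplying the contact equation of [K2] by the common ratio gives that of [K1]. *)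
Lemma radial_ratio_eq xi theta : inv_gauss K2 xi theta -> s theta = r xi ->
  inv_gauss K1 xi theta.
Proof.
move=> H sr; have [Sx St E] := (inv_gaussP K2_body K2_0 xi theta).1 H.
apply/inv_gaussP => //; split=> //.
have -> : radial K1 theta = s theta * radial K2 theta.
  by rewrite /s divfK// gt_eqF// radial_gt0.
by rewrite -mulrA E sr /r divfK// gt_eqF// support_gt0// sphere_neq0.
Qed.

Context (kap : R -> R).
Hypotheses (kap_meas : measurable_fun [set: RR] (kap : RR -> RR))
  (kap_ge0 : forall x, 0 < x -> 0 <= kap x)
  (kap_homo : forall x y, 0 < x -> x <= y -> kap x <= kap y)
  (kapq_homo : forall x y, 0 < x -> x <= y ->
     x `^ (- q) * kap x <= y `^ (- q) * kap y).

Let lower xi := f xi * h1 xi `^ p * (r xi `^ (- q) * kap (r xi)).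
Let middle xi := f xi * h2 xi `^ p * kap (s (th2 xi)).
Let upper xi := f xi * h2 xi `^ p * kap (r xi).

Let f_gt0 xi : sphere xi -> 0 < f xi.
Proof. by move=> /f_bnd /andP[]. Qed.

Let f_ge0 xi : sphere xi -> 0 <= f xi.
Proof. by move/f_gt0/ltW. Qed.

Let mS := @measurable_sphere R m.

Let bS : borel (sphere : set V).
Proof. by apply: measurable_closed; exact: closed_sphere. Qed.

Let ms : measurable_fun (sphere : set (borel_rV R m)) (s : borel_rV R m -> RR).
Proof.
apply: measurable_fun_div_gt0; first exact: radial_gt0.
  exact: measurable_radial.
exact: measurable_radial.
Qed.

Let mh K : convex_body K -> K° 0 ->
  measurable_fun (sphere : set (@sphere_type R m)) (support K : sphere_type -> RR).
Proof.
move=> Kb K0; apply: measurable_fun_borel => //.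
exact: measurable_funS (measurable_support Kb K0).
Qed.

Let mr : measurable_fun (sphere : set (@sphere_type R m)) (r : sphere_type -> RR).
Proof.
apply: measurable_fun_div_gt0; [|exact: mh|exact: mh].
by move=> x /sphere_neq0 x0; exact: support_gt0.
Qed.

Lemma measurable_comparison_upper :
  measurable_fun (sphere : set (@sphere_type R m)) (upper : sphere_type -> RR).
Proof.
have m1 := measurableT_comp (@measurable_powR R p) (mh K2_body K2_0).
exact: (measurable_funM (measurable_funM f_meas m1) (measurableT_comp kap_meas mr)).
Qed.

Lemma measurable_comparison_lower :
  measurable_fun (sphere : set (@sphere_type R m)) (lower : sphere_type -> RR).
Proof.
have m1 := measurableT_comp (@measurable_powR R p) (mh K1_body K1_0).
have m2 := measurableT_comp (@measurable_powR R (- q)) mr.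
exact: (measurable_funM (measurable_funM f_meas m1)
  (measurable_funM m2 (measurableT_comp kap_meas mr))).
Qed.

Lemma comparison_upper_ge0 xi : sphere xi -> 0 <= upper xi.
Proof.
move=> Sx; rewrite !mulr_ge0 ?powR_ge0 ?f_ge0//.
exact/kap_ge0/support_ratio_gt0.
Qed.

Lemma comparison_lower_ge0 xi : sphere xi -> 0 <= lower xi.
Proof.
move=> Sx; rewrite !mulr_ge0 ?powR_ge0 ?f_ge0//.
exact/kap_ge0/support_ratio_gt0.
Qed.

Lemma support_ratio_bounded : exists C, forall xi, sphere xi -> r xi <= C.
Proof.
have [M HM] := support_le_bound K1_body K1_0.
have [c c0 Hc] := support_ge K2_body K2_0.
exists (M / c) => xi Sx; have x0 := sphere_neq0 Sx.
rewrite ler_pM ?HM ?invr_ge0 ?(ltW (support_gt0 _ _ x0))//.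
by rewrite lef_pV2 ?posrE ?support_gt0 ?Hc.
Qed.

Lemma comparison_upper_fin : (\int[mu]_(xi in sphere) (upper xi)%:E < +oo)%E.
Proof.
have [C HC] := support_ratio_bounded.
have [M HM] := support_le_bound K2_body K2_0.
have [c c0 Hc] := support_ge K2_body K2_0.
apply: (@integral_sphere_fin _ _ _ (Lam * (c `^ p + M `^ p) * kap C)) => [|x Sx].
  exact: measurable_comparison_upper.
have x0 := sphere_neq0 Sx.
rewrite comparison_upper_ge0//= ler_pM ?mulr_ge0 ?powR_ge0 ?f_ge0//.
- exact/kap_ge0/support_ratio_gt0.
- rewrite ler_pM ?powR_ge0 ?f_ge0//; first by case/andP: (f_bnd Sx).
  by apply: powR_le_endpoints => //; rewrite Hc ?HM.
- by apply: kap_homo; [exact: support_ratio_gt0|exact: HC].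
Qed.

Lemma integral_sphere_regular (K : set V) (u : V -> R) : convex_body K -> K° 0 ->
  measurable_fun (sphere : set (@sphere_type R m)) (u : sphere_type -> RR) ->
  (forall xi, sphere xi -> 0 <= u xi) ->
  (\int[mu]_(xi in sphere) (u xi)%:E =
   \int[mu]_(xi in sphere `\` singular_normals K) (u xi)%:E)%E.
Proof.
move=> Kb K0 mu0 u0.
have mN : measurable (singular_normals K : set (@sphere_type R m)).
  by apply: measurable_borel; exact: borel_singular_normals.
have muE : measurable_fun (sphere : set (@sphere_type R m)) (fun x => (u x)%:E).
  exact/measurable_EFinP.
have uE0 (x : @sphere_type R m) : sphere x -> (0 <= (u x)%:E)%E.
  by move=> Sx; rewrite lee_fin u0.
exact: (ge0_negligible_integral mN mS muE uE0 (sphere_measure_singular_normals Kb K0)).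
Qed.

Lemma measurable_comparison_middle : measurable_fun
  (sphere `\` N2 : set (@sphere_type R m)) (middle : sphere_type -> RR).
Proof.
have mS2 : measurable (sphere `\` N2 : set (@sphere_type R m)).
  apply: measurableD => //.
  by apply: measurable_borel; exact: borel_singular_normals.
have S2S : sphere `\` N2 `<=` sphere by move=> x [].
have m0 := measurable_funS mS S2S f_meas.
have m1 := measurableT_comp (@measurable_powR R p)
  (measurable_funS mS S2S (mh K2_body K2_0)).
have m2 := measurableT_comp kap_meas (measurable_inv_gauss_comp K2_body K2_0 ms).
exact: (measurable_funM (measurable_funM m0 m1) m2).
Qed.

Lemma comparison_middle_le xi : sphere xi -> 0 <= middle xi <= upper xi.
Proof.
move=> Sx; have H := inv_gauss_funP K2_body K2_0 Sx.
have [_ St _] := (inv_gaussP K2_body K2_0 _ _).1 H.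
have s0 := radial_ratio_gt0 St.
rewrite !mulr_ge0 ?powR_ge0 ?f_ge0 ?kap_ge0//=.
rewrite ler_wpM2l ?mulr_ge0 ?powR_ge0 ?f_ge0//.
by apply: kap_homo => //; exact: radial_ratio_le.
Qed.

(* Both ends of the transport of the function
   [(radial K2) ^ q * kap (radial_ratio)] against [g]. *)
Lemma comparison : (\int[mu]_(xi in sphere) (lower xi)%:E <=
  \int[mu]_(xi in sphere `\` N2) (middle xi)%:E)%E.
Proof.
(* The power of the radius cancels the one in the density of [K2]; in the density of [K1] it leaves
   the factor s^(-q), whence the second monotonicity condition on [kap]. *)
pose a theta := radial K2 theta `^ q * kap (s theta).
have ma : measurable_fun (sphere : set (borel_rV R m)) (a : borel_rV R m -> RR).
  apply: measurable_funM.
    apply: (measurableT_comp (measurable_powR q)); exact: measurable_radial.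
  exact: (measurableT_comp kap_meas).
have a0 theta : sphere theta -> 0 <= a theta.
  by move=> St; rewrite mulr_ge0 ?powR_ge0// kap_ge0// radial_ratio_gt0.
have g_meas := measurable_lipschitz_sphere g_lip.
have g_fin : (\int[mu]_(theta in sphere) (g theta)%:E < +oo)%E.
  have [M gM] := lipschitz_sphere_bounded g_lip.
  apply: (@integral_sphere_fin _ _ _ M); first exact: measurable_fun_borel.
  by move=> x Sx; rewrite (ltW (g_gt0 Sx)) gM.
have T1 := transport K1_body K1_0 f_meas f_ge0 g_meas g_gt0 g_fin K1_sol ma a0.
have T2 := transport K2_body K2_0 f_meas f_ge0 g_meas g_gt0 g_fin K2_sol ma a0.
have -> : (\int[mu]_(xi in sphere `\` N2) (middle xi)%:E =
    \int[mu]_(theta in sphere) (g theta * a theta)%:E)%E.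
  rewrite T2; apply: eq_integral => x; rewrite inE => -[Sx nx].
  have [_ St _] := (inv_gaussP K2_body K2_0 _ _).1 (inv_gauss_funP K2_body K2_0 Sx).
  rewrite /middle /a mulrA -[_ * radial _ _ `^ (- q) * _]mulrA -powRD; last first.
    by apply/implyP => _; rewrite gt_eqF// radial_gt0.
  by rewrite addNr powRr0 mulr1.
rewrite T1 (integral_sphere_regular K1_body K1_0 measurable_comparison_lower
  comparison_lower_ge0).
have mN1 : measurable (N1 : set (@sphere_type R m)).
  by apply: measurable_borel; exact: borel_singular_normals.
have mS1 : measurable (sphere `\` N1 : set (@sphere_type R m)) by exact: measurableD.
have S1S : sphere `\` N1 `<=` sphere by move=> x [].
have l0 (x : @sphere_type R m) : (sphere `\` N1) x -> (0 <= (lower x)%:E)%E.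
  by move=> [Sx _]; rewrite lee_fin comparison_lower_ge0.
have ml : measurable_fun (sphere `\` N1 : set (@sphere_type R m))
    (fun x => (lower x)%:E).
  by apply/measurable_EFinP; exact: (measurable_funS mS S1S measurable_comparison_lower).
have mt : measurable_fun (sphere `\` N1 : set (@sphere_type R m)) (fun x =>
    (f x * h1 x `^ p * radial K1 (th1 x) `^ (- q) * a (th1 x))%:E).
  apply/measurable_EFinP; exact: (measurable_funM
    (measurable_density K1_body K1_0 p q f_meas)
    (measurable_inv_gauss_comp K1_body K1_0 ma)).
apply: (ge0_le_integral mu mS1 l0 ml mt).
move=> x [Sx _]; rewrite lee_fin /lower /a -[leRHS]mulrA.
have H := inv_gauss_funP K1_body K1_0 Sx.
have [_ St _] := (inv_gaussP K1_body K1_0 _ _).1 H.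
have fh0 : 0 <= f x * h1 x `^ p by rewrite mulr_ge0 ?powR_ge0 ?f_ge0.
rewrite ler_wpM2l//.
have -> : radial K1 (th1 x) `^ (- q) * (radial K2 (th1 x) `^ q * kap (s (th1 x))) =
    s (th1 x) `^ (- q) * kap (s (th1 x)).
  rewrite mulrA; congr (_ * _); rewrite /s powRM ?invr_ge0 ?ltW ?radial_gt0//.
  congr (_ * _); rewrite -powR_inv1 ?ltW ?radial_gt0// -powRrM.
  by rewrite mulrNN mul1r.
by apply: kapq_homo; [exact: support_ratio_gt0|exact: radial_ratio_ge].
Qed.

End comparison.

(** Passes from almost every normal to every normal: a closed condition that holds almost everywhere
    on the sphere holds everywhere. *)
Lemma sphere_null_open {R : realType} {m : nat} (U : set 'rV[R]_m)
    (Z : set (@sphere_type R m)) : (0 < m)%N -> open U -> measurable Z ->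
  sphere_measure Z = 0%E -> U `&` sphere `<=` Z -> U `&` sphere = set0.
Proof.
move=> m0 oU mZ Z0 UZ; apply/eqP; apply: contraT => /set0P U0.
have := sphere_measure_open_gt0 m0 oU U0.
have -> : sphere_measure (U : set (@sphere_type R m)) =
    sphere_measure (U `&` sphere : set (@sphere_type R m)).
  by rewrite /sphere_measure /sphere_outer_measure -setIA setIid.
have mU : measurable (U `&` sphere : set (@sphere_type R m)).
  apply: measurableI; last exact: measurable_sphere.
  by apply: measurable_borel; exact: measurable_open.
by rewrite (subset_measure0 mU mZ UZ Z0) ltxx.
Qed.

(** Of two orthogonal coordinate vectors, at most one is [xi] or its opposite. *)
Lemma sphere_opposite_third {R : realType} {n : nat} (xi : 'rV[R]_n.+1) :
  (0 < n)%N -> sphere xi -> exists2 eta, sphere eta & eta != xi /\ eta != - xi.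
Proof.
case: n xi => // n xi _ Sxi.
pose e (i : 'I_n.+2) : 'rV[R]_n.+2 := delta_mx ord0 i.
have Se i : sphere (e i).
  rewrite /sphere /= /dot (bigD1 i)//= big1 ?addr0; last first.
    by move=> j ji; rewrite !mxE eqxx/= (negbTE ji) mulr0.
  by rewrite !mxE !eqxx mulr1.
pose i0 : 'I_n.+2 := ord0; pose i1 : 'I_n.+2 := lift ord0 ord0.
have d01 : dot (e i0) (e i1) = 0.
  by apply: big1 => j _; rewrite !mxE eqxx/=; case: eqVneq => [->|];
    rewrite ?mulr0 ?mul0r.
have xi1 : dot xi xi != 0 by rewrite Sxi oner_eq0.
have [E0|/not_orP[n1 n2]] := pselect (e i0 = xi \/ e i0 = - xi); last first.
  by exists (e i0) => //; split; exact/eqP.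
exists (e i1) => //; split; apply: contraNneq xi1 => E1; move: d01; rewrite E1;
  by case: E0 => ->; rewrite ?dotNl ?dotNr ?opprK => /eqP; rewrite ?oppr_eq0.
Qed.

(** * The cases p > q and p = q *)

Section uniqueness.
Context {R : realType} {n : nat} (K1 K2 : set 'rV[R]_n.+1).
Hypotheses (n_gt0 : (0 < n)%N).
Hypotheses (K1_body : convex_body K1) (K2_body : convex_body K2).
Hypotheses (K1_0 : K1° 0) (K2_0 : K2° 0).
Context (p q Lam : R) (f g : 'rV[R]_n.+1 -> R).
Local Notation RR := (measurableTypeR R).
Local Notation mu := (@sphere_measure R n.+1).
Local Notation h1 := (support K1).
Local Notation h2 := (support K2).
Local Notation r := (support_ratio K1 K2).
Local Notation s := (radial_ratio K1 K2).
Local Notation N2 := (singular_normals K2).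
Hypotheses
  (f_meas : measurable_fun (sphere : set (@sphere_type R n.+1)) (f : sphere_type -> RR))
  (f_bnd : forall xi, sphere xi -> 0 < f xi <= Lam)
  (g_gt0 : forall theta, sphere theta -> 0 < g theta)
  (g_lip : [lipschitz g x | x in sphere])
  (K1_sol : generalized_solution p q f g K1)
  (K2_sol : generalized_solution p q f g K2).

Section weight.
Context (w : R -> R).
Hypotheses (w_meas : measurable_fun [set: RR] (w : RR -> RR))
  (w_ge0 : forall x, 0 < x -> 0 <= w x)
  (w_homo : forall x y, 0 < x -> x <= y -> w x <= w y).

(** Both exponents max(q,0) and max(q,0) - q are nonnegative, so [kap] and its product with x^(-q)
    are nondecreasing as soon as [w] is. *)
Let kap x := w x * x `^ (Num.max q 0).

Let q0 : 0 <= Num.max q 0. Proof. by rewrite le_max lexx orbT. Qed.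

Let mk : measurable_fun [set: RR] (kap : RR -> RR).
Proof. exact: (measurable_funM w_meas (@measurable_powR R (Num.max q 0))). Qed.

Let k_ge0 x : 0 < x -> 0 <= kap x.
Proof. by move=> x0; rewrite mulr_ge0 ?powR_ge0 ?w_ge0. Qed.

Let powR_homo (k x y : R) : 0 <= k -> 0 < x -> x <= y -> x `^ k <= y `^ k.
Proof.
by move=> k0 x0 xy; rewrite ge0_ler_powR// nnegrE ltW// (lt_le_trans x0).
Qed.

Let k_homo x y : 0 < x -> x <= y -> kap x <= kap y.
Proof.
by move=> x0 xy; rewrite ler_pM ?powR_ge0 ?w_ge0 ?w_homo ?powR_homo.
Qed.

Let kq_homo x y : 0 < x -> x <= y -> x `^ (- q) * kap x <= y `^ (- q) * kap y.
Proof.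
move=> x0 xy; have y0 := lt_le_trans x0 xy.
have E z : 0 < z -> z `^ (- q) * kap z = w z * z `^ (Num.max q 0 - q).
  move=> z0; rewrite powRD; last by apply/implyP => _; rewrite gt_eqF.
  by rewrite /kap mulrCA mulrA [_ * z `^ (- q)]mulrC mulrA.
rewrite !E// ler_pM ?powR_ge0 ?w_ge0 ?w_homo ?powR_homo//.
by rewrite subr_ge0 le_max lexx.
Qed.

Let rE xi : sphere xi -> h1 xi `^ p * (r xi `^ (- q) * kap (r xi)) =
  h2 xi `^ p * kap (r xi) * r xi `^ (p - q).
Proof.
move=> Sx; have x0 := sphere_neq0 Sx.
have r0 := support_ratio_gt0 K1_body K2_body K1_0 K2_0 Sx.
have -> : h1 xi = r xi * h2 xi by rewrite /r divfK// gt_eqF// support_gt0.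
rewrite powRM ?(ltW r0) ?ltW ?support_gt0//.
rewrite powRD; last by apply/implyP => _; rewrite gt_eqF.
ring.
Qed.

Definition lower_integrand xi := f xi * h1 xi `^ p * (r xi `^ (- q) * kap (r xi)).
Definition middle_integrand xi := f xi * h2 xi `^ p * kap (s (inv_gauss_fun K2 xi)).
Definition upper_integrand xi := f xi * h2 xi `^ p * kap (r xi).

Lemma weighted_comparison : [/\
  (forall xi, sphere xi -> lower_integrand xi = upper_integrand xi * r xi `^ (p - q)),
  (\int[mu]_(xi in sphere) (lower_integrand xi)%:E <=
    \int[mu]_(xi in sphere `\` N2) (middle_integrand xi)%:E)%E,
  (\int[mu]_(xi in sphere `\` N2) (middle_integrand xi)%:E <=
    \int[mu]_(xi in sphere) (upper_integrand xi)%:E)%E &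
  (\int[mu]_(xi in sphere) (upper_integrand xi)%:E < +oo)%E].
Proof.
split.
- by move=> xi Sx; rewrite /lower_integrand /upper_integrand -mulrA rE// !mulrA.
- exact: (comparison K1_body K2_body K1_0 K2_0 f_meas f_bnd g_gt0 g_lip
    K1_sol K2_sol mk k_ge0 kq_homo).
- have Kr := @integral_sphere_regular R n.+1 K2 upper_integrand K2_body K2_0.
  rewrite Kr; last 2 first.
  + exact: (measurable_comparison_upper K1_body K2_body K1_0 K2_0 p f_meas mk).
  + by move=> xi Sx;
    exact: (comparison_upper_ge0 K1_body K2_body K1_0 K2_0 p f_bnd k_ge0 Sx).
  have M0 (x : @sphere_type R n.+1) : (sphere `\` N2) x ->
    (0 <= (middle_integrand x)%:E)%E.
    move=> [Sx _]; rewrite lee_fin.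
    by case/andP:
      (comparison_middle_le K1_body K2_body K1_0 K2_0 p f_bnd k_ge0 k_homo Sx).
  have mS2 : measurable (sphere `\` N2 : set (@sphere_type R n.+1)).
    apply: measurableD; first exact: measurable_sphere.
    by apply: measurable_borel; exact: borel_singular_normals.
  have S2S : sphere `\` N2 `<=` sphere by move=> x [].
  have mM : measurable_fun (sphere `\` N2 : set (@sphere_type R n.+1))
      (fun x => (middle_integrand x)%:E).
    apply/measurable_EFinP.
    exact: (measurable_comparison_middle K1_body K2_body K1_0 K2_0 p f_meas mk).
  have mU : measurable_fun (sphere `\` N2 : set (@sphere_type R n.+1))
      (fun x => (upper_integrand x)%:E).
    apply/measurable_EFinP; apply: (measurable_funS measurable_sphere S2S).
    exact: (measurable_comparison_upper K1_body K2_body K1_0 K2_0 p f_meas mk).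
  apply: (ge0_le_integral mu mS2 M0 mM mU) => x [Sx _]; rewrite lee_fin.
  by case/andP: (comparison_middle_le K1_body K2_body K1_0 K2_0 p f_bnd k_ge0 k_homo Sx).
- exact: (comparison_upper_fin K1_body K2_body K1_0 K2_0 p f_meas f_bnd mk k_ge0 k_homo).
Qed.

Lemma weighted_measurable : [/\
  measurable_fun (sphere : set (@sphere_type R n.+1))
    (lower_integrand : sphere_type -> RR),
  measurable_fun (sphere : set (@sphere_type R n.+1))
    (upper_integrand : sphere_type -> RR) &
  measurable_fun (sphere `\` N2 : set (@sphere_type R n.+1))
    (middle_integrand : sphere_type -> RR)].
Proof.
split.
- exact: (measurable_comparison_lower K1_body K2_body K1_0 K2_0 p q f_meas mk).
- exact: (measurable_comparison_upper K1_body K2_body K1_0 K2_0 p f_meas mk).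
- exact: (measurable_comparison_middle K1_body K2_body K1_0 K2_0 p f_meas mk).
Qed.

Lemma weighted_middle_le xi : sphere xi -> 0 <= middle_integrand xi <= upper_integrand xi.
Proof.
exact: (comparison_middle_le K1_body K2_body K1_0 K2_0 p f_bnd k_ge0 k_homo).
Qed.

Lemma weighted_upper_ge0 xi : sphere xi -> 0 <= upper_integrand xi.
Proof.
exact: (comparison_upper_ge0 K1_body K2_body K1_0 K2_0 p f_bnd k_ge0).
Qed.

End weight.

Let f_gt0 xi : sphere xi -> 0 < f xi.
Proof. by move=> /f_bnd /andP[]. Qed.

Lemma solution_subset : q < p -> K1 `<=` K2.
Proof.
(* Where r <= 1 the upper and lower integrands vanish; where r > 1 the lower one is strictly larger,
   by the factor r^(p-q). Since its integral is not larger, the latter set is null. *)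
move=> qp; pose w (x : R) := Num.max (x - 1) 0.
have w_meas : measurable_fun [set: RR] (w : RR -> RR).
  apply: (@measurable_maxr _ RR R setT (fun x => x - 1) (cst 0));
    last exact: measurable_cst.
  by apply: measurable_funB; [exact: measurable_id|exact: measurable_cst].
have w_ge0 x : 0 < x -> 0 <= w x by move=> _; rewrite le_max lexx orbT.
have w_homo x y : 0 < x -> x <= y -> w x <= w y.
  by move=> _ xy; rewrite ge_max !le_max lexx !orbT lerD2r xy.
have [luE lm mu_ ufin] := weighted_comparison w_meas w_ge0 w_homo.
have [ml mup _] := weighted_measurable w_meas.
have u0 := weighted_upper_ge0 w_ge0.
have r0 xi : sphere xi -> 0 < r xi by exact: support_ratio_gt0.
have pq : 0 < p - q by rewrite subr_gt0.
have upper0 xi : r xi <= 1 -> upper_integrand w xi = 0.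
  by move=> r1; rewrite /upper_integrand /w max_r ?mul0r ?mulr0// subr_le0.
have r1pq xi : 1 < r xi -> 1 < r xi `^ (p - q).
  move=> r1; rewrite [ltLHS](_ : 1 = 1 `^ (p - q)); last by rewrite powR1.
  by rewrite gt0_ltr_powR// nnegrE ltW// (lt_trans ltr01).
have ul xi : sphere xi -> 0 <= upper_integrand w xi <= lower_integrand w xi.
  move=> Sx; rewrite u0//= luE//; have [r1|r1] := leP (r xi) 1.
    by rewrite upper0// mul0r.
  by rewrite ler_peMr ?u0// ltW// r1pq.
have [Z [mZ Z0 HZ]] := ge0_integral_le_ae_eq measurable_sphere mup ml ul
  (le_trans lm mu_) ufin.
pose U : set 'rV[R]_n.+1 := [set xi | h2 xi < h1 xi].
have oU : open U by apply: open_lt_fun; exact: continuous_support.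
have US0 : U `&` sphere = set0.
  apply: (sphere_null_open _ oU mZ Z0) => // xi [Ux Sx]; apply: contrapT => nZ.
  have r1 : 1 < r xi.
    by rewrite ltr_pdivlMr ?mul1r// support_gt0// sphere_neq0.
  have := HZ xi Sx nZ; rewrite luE// => /esym/eqP; apply/negP.
  rewrite gt_eqF// ltr_pMr ?r1pq// /upper_integrand.
  rewrite !mulr_gt0 ?f_gt0 ?powR_gt0 ?support_gt0 ?sphere_neq0 ?r0//.
  by rewrite lt_max subr_gt0 r1.
apply: body_subset => // xi Sx; rewrite leNgt; apply/negP => Ux.
by have : (U `&` sphere) xi by []; rewrite US0.
Qed.

Lemma solution_parallel_faces : p = q ->
  forall xi, sphere xi -> parallel_faces K1 K2 xi.
Proof.
(* Here [kap] must be strictly increasing, so that equal values of [kap] force equal ratios. *)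
move=> pq; pose w (x : R) := x.
have w_meas : measurable_fun [set: RR] (w : RR -> RR) by exact: measurable_id.
have w_ge0 x : 0 < x -> 0 <= w x by exact: ltW.
have w_homo x y : 0 < x -> x <= y -> w x <= w y by [].
have [luE lm mu_ ufin] := weighted_comparison w_meas w_ge0 w_homo.
have [ml mup mm] := weighted_measurable w_meas.
have u0 := weighted_upper_ge0 w_ge0.
have mS2 : measurable (sphere `\` N2 : set (@sphere_type R n.+1)).
  apply: measurableD; first exact: measurable_sphere.
  by apply: measurable_borel; exact: borel_singular_normals.
have S2S : sphere `\` N2 `<=` sphere by move=> x [].
have UE := integral_sphere_regular K2_body K2_0 mup u0.
have [|||Z [mZ Z0 HZ]] := ge0_integral_le_ae_eq (mu := mu) mS2 mm
    (measurable_funS measurable_sphere S2S mup).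
- by move=> x [Sx _]; exact: weighted_middle_le.
- rewrite -UE (le_trans _ lm)//
  (eq_integral (fun x : @sphere_type R n.+1 => (lower_integrand w x)%:E))//.
  by move=> x; rewrite inE => Sx; rewrite luE// pq subrr powRr0 mulr1.
- exact: le_lt_trans mu_ ufin.
have good xi : sphere xi -> ~ (N2 `|` Z) xi -> parallel_faces K1 K2 xi.
  move=> Sx /not_orP[nN nZ].
  have H2 := inv_gauss_funP K2_body K2_0 Sx.
  apply: (common_inv_gauss_parallel K1_body K2_body K1_0 K2_0 _ H2).
  apply: (radial_ratio_eq K1_body K2_body K1_0 K2_0) => //.
  have St : sphere (inv_gauss_fun K2 xi) by have [] := (inv_gaussP K2_body K2_0 _ _).1 H2.
  have s0 := radial_ratio_gt0 K1_body K2_body K1_0 K2_0 St.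
  have := HZ xi (conj Sx nN) nZ; rewrite /middle_integrand /upper_integrand.
  have c0 : f xi * h2 xi `^ p != 0.
    by rewrite gt_eqF// mulr_gt0 ?f_gt0 ?powR_gt0 ?support_gt0 ?sphere_neq0.
  move/(mulfI c0) => E; apply/eqP; rewrite eq_le radial_ratio_le//=.
  rewrite leNgt; apply/negP => sr; move/eqP: E; apply/negP.
  rewrite lt_eqF// /w.
  apply: (@lt_le_trans _ _ (r xi * s (inv_gauss_fun K2 xi) `^ Num.max q 0)).
    by rewrite ltr_pM2r// powR_gt0.
  rewrite ler_wpM2l ?(ltW (lt_trans s0 sr))// ge0_ler_powR ?nnegrE//.
  - by rewrite le_max lexx orbT.
  - exact: ltW.
  - exact: ltW (lt_trans s0 sr).
  - exact: ltW.
move=> xi Sx; apply: contrapT => nP.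
pose U := ~` parallel_faces K1 K2.
have oU : open U by apply: closed_openC; exact: closed_parallel_faces.
have mN2 : measurable (N2 : set (@sphere_type R n.+1)).
  by apply: measurable_borel; exact: borel_singular_normals.
have NZ0 : mu (N2 `|` Z) = 0%E.
  have N20 := sphere_measure_singular_normals K2_body K2_0.
  by rewrite (measureU0 mN2 mZ Z0).
have US0 : U `&` sphere = set0.
  apply: (sphere_null_open _ oU (measurableU _ _ mN2 mZ) NZ0) => // eta [nPe Se].
  by apply: contrapT => nZ; apply: nPe; exact: good.
by have : (U `&` sphere) xi by []; rewrite US0.
Qed.

Lemma solution_dilation : p = q -> exists c, 0 < c /\ K1 = [set c *: x | x in K2].
Proof.
move=> /solution_parallel_faces par.
have seg xi eta : sphere xi -> sphere eta -> eta != - xi -> r eta = r xi.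
  move=> Sx Se exi; apply: support_ratio_segment => // t t01.
  rewrite (_ : _ + _ = (1 - t) *: xi + t *: eta); last first.
    by apply/rowP => i; rewrite !mxE; ring.
  apply: contraNneq exi => E.
  (* Comparing the lengths of both sides gives t = 1 - t, and then [eta] would be the antipode of
     [xi]. *)
  have E' : t *: eta = - ((1 - t) *: xi) by apply/eqP; rewrite -addr_eq0 addrC E.
  have sq : t * t = (1 - t) * (1 - t).
    have := congr1 (fun z => dot z z) E'.
    by rewrite dotNl dotNr opprK !dotZl !dotZr Sx Se !mulr1.
  have t2 : t = 2^-1 by lra.
  have t0 : t != 0 by rewrite t2 invr_eq0 pnatr_eq0.
  apply/eqP; apply: (scalerI t0); rewrite E' scalerN; congr (- (_ *: _)).
  by rewrite t2; lra.
pose xi0 : 'rV[R]_n.+1 := normalize (const_mx 1).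
have Sxi0 : sphere xi0.
  apply: normalize_sphere; apply/eqP => /rowP /(_ ord0); rewrite !mxE => /eqP.
  by rewrite oner_eq0.
have rc eta : sphere eta -> r eta = r xi0.
  move=> Se; have [->|exi] := eqVneq eta (- xi0); last exact: seg.
  (* The segment from [xi0] to its antipode meets the origin, so the ratio is carried over through
     [z]. *)
  have [z Sz [z1 z2]] := sphere_opposite_third n_gt0 Sxi0.
  have SN : sphere (- xi0) by rewrite /sphere /= dotNl dotNr opprK.
  rewrite -(seg xi0 z)//; apply: seg => //.
  by rewrite eqr_opp eq_sym.
exists (r xi0); split; first exact: support_ratio_gt0.
apply: body_scale => //; first exact: support_ratio_gt0.
move=> xi Sx; rewrite -(rc _ Sx) /r divfK// gt_eqF// support_gt0// sphere_neq0//.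
Qed.

End uniqueness.

Theorem theorem1p6 (R : realType) (n : nat) (n_gt0 : (0 < n)%N)
  (p q lam Lam : R) (lam_gt0 : 0 < lam) (lam_le_Lam : lam <= Lam)
  (f g : 'rV[R]_n.+1 -> R)
  (f_meas : measurable_fun (sphere : set (@sphere_type R n.+1))
    (f : sphere_type -> measurableTypeR R))
  (f_bnd : forall xi, sphere xi -> lam <= f xi <= Lam)
  (g_gt0 : forall theta, sphere theta -> 0 < g theta)
  (g_lip : [lipschitz g x | x in sphere])
  (K1 K2 : set 'rV[R]_n.+1)
  (K1_body : convex_body K1) (K2_body : convex_body K2)
  (K1_0 : K1° 0) (K2_0 : K2° 0)
  (K1_sol : generalized_solution p q f g K1)
  (K2_sol : generalized_solution p q f g K2) :
  (q < p -> K1 = K2) /\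
  (p = q -> exists c : R, 0 < c /\ K1 = [set c *: x | x in K2]).
Proof.
have f_bnd' xi : sphere xi -> 0 < f xi <= Lam.
  by move=> /f_bnd /andP[lf ->]; rewrite (lt_le_trans lam_gt0).
split=> [qp|pq].
  apply/seteqP; split.
    exact: (solution_subset K1_body K2_body K1_0 K2_0 f_meas f_bnd' g_gt0 g_lip
      K1_sol K2_sol qp).
  exact: (solution_subset K2_body K1_body K2_0 K1_0 f_meas f_bnd' g_gt0 g_lip
    K2_sol K1_sol qp).
exact: (solution_dilation n_gt0 K1_body K2_body K1_0 K2_0 f_meas f_bnd' g_gt0
  g_lip K1_sol K2_sol pq).
Qed.
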